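(* Every planar graph with no $4$-cycle (as a subgraph) is $(0,0,117)$-colorable, i.e., its vertex set can be partitioned into two independent sets and a third set inducing a subgraph of maximum degree at most $117$.
   Context: All graphs are finite and simple. *)

(* Defs.v *)
From HB Require Import structures.
From mathcomp Require Import all_boot all_order all_algebra.
From mathcomp Require Import all_classical all_reals all_analysis.

Set Implicit Arguments.
Unset Strict Implicit.
Unset Printing Implicit Defensive.

Import Order.TTheory GRing.Theory Num.Theory.
Import numFieldNormedType.Exports.

Local Open Scope classical_set_scope.
Local Open Scope ring_scope.

(* The plane is R * R with its product topology. A simple graph is a finType  *)
(* of vertices with a symmetric irreflexive adjacency relation.               *)

Definition simple_arc (R : realType) (x y : R * R) (A : set (R * R)) : Prop :=
  exists g : R -> R * R,
    [/\ {within `[0, 1], continuous g}, {in `[0, 1] &, injective g},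
        g 0 = x, g 1 = y & A = g @` `[0, 1]].

(* An edge {u, v} is drawn as the set A u v, which must equal A v u; values   *)
(* of A at non-adjacent pairs are irrelevant. By the last two fields, a point *)
(* common to two distinct edges is the position of a common endpoint.         *)
Record plane_drawing (R : realType) (V : finType) (adj : rel V)
    (pos : V -> R * R) (A : V -> V -> set (R * R)) : Prop := PlaneDrawing {
  pos_inj : injective pos;
  edge_arc : forall u v, adj u v -> simple_arc (pos u) (pos v) (A u v);
  edge_sym : forall u v, adj u v -> A u v = A v u;
  edge_vertex : forall u v w, adj u v -> A u v (pos w) -> w = u \/ w = v;
  edge_cross : forall u v x y, adj u v -> adj x y ->
    ([set u; v] != [set x; y] :> {set V})%SET ->
    A u v `&` A x y `<=` range pos }.

Definition planar (R : realType) (V : finType) (adj : rel V) : Prop :=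
  exists (pos : V -> R * R) (A : V -> V -> set (R * R)),
    plane_drawing adj pos A.

(* A cycle of length k (k >= 3), as a not necessarily induced subgraph.       *)
Definition has_kcycle (V : finType) (adj : rel V) (k : nat) : Prop :=
  exists s : seq V, [/\ size s = k, uniq s & cycle adj s].

Definition independent (V : finType) (adj : rel V) (S : {set V}) : Prop :=
  {in S &, forall u v, ~~ adj u v}.

Definition induced_max_degree (V : finType) (adj : rel V) (S : {set V}) : nat :=
  (\max_(v in S) #|[set u in S | adj v u]%SET|)%N.

(* Main.v *)
Require Import Defs.
From HB Require Import structures.
From mathcomp Require Import all_boot all_order all_fingroup all_algebra.
From mathcomp Require Import zify.

Set Implicit Arguments.
Unset Strict Implicit.
Unset Printing Implicit Defensive.

Import Order.TTheory GRing.Theory Num.Theory.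

(** In a minimal counterexample, call a vertex big if its degree is at least 120.
    Every non-isolated vertex has degree at least 3, and a big neighbour unless it
    is big itself. Call a vertex plain if it has degree 3 and exactly one big
    neighbour. The neighbours of a big vertex w belong to at least 118 components
    of the graph induced by the plain vertices (other vertices count separately):
    otherwise two neighbours of w in the third part lie in one component, and
    recolouring along a plain path between them removes one of the two from this
    part. Give each vertex of degree d the charge 3d/2 - 5 and each face of length
    l the charge l - 5, with negative total by Euler's formula; big vertices pass
    their charge to small neighbours and to triangles, and recover 1/20 for each
    change of component in the rotation around them, so that no final charge is
    negative.

    Euler's formula for a drawing comes from a square grid so fine that no cell
    meets two disjoint pieces of the drawing: the cells around a vertex and the
    beginnings of its edges contract to a vertex. The grid is planar by direct
    computation, and the inequality defining planarity of a hypermap survives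
    edge contractions and deletions. *)

(** * Planar hypermaps: invariance, splitting and merging of orbits *)

Section Hypermaps.
Variable D : finType.
Implicit Types (e n s : {perm D}) (x y z : D).
Local Open Scope group_scope.

Definition inv_under (T : Type) s (c : D -> T) := forall z, c (s z) = c z.

(* Genus zero for the hypermap with permutations e, n and e * n: as soon as c
   separates the connected components, equality holds in Euler's formula. *)
Definition planar_hypermap e n := forall (T : finType) (c : D -> T),
  inv_under e c -> inv_under n c ->
  #|D| + (2 * #|c @: D|)%N <= #|porbits e| + #|porbits n| + #|porbits (e * n)|.

Lemma inv_under_exp (T : Type) s (c : D -> T) i z :
  inv_under s c -> c ((s ^+ i) z) = c z.
Proof.
by move=> cs; elim: i z => [|i IHi] z; rewrite ?perm1 // expgS permM IHi cs.
Qed.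

Lemma inv_under_porbit (T : Type) s (c : D -> T) x y :
  inv_under s c -> x \in porbit s y -> c x = c y.
Proof. by move=> cs /porbitP[i ->]; apply: inv_under_exp. Qed.

Lemma inv_under_tperm (T : Type) (c : D -> T) x y :
  c x = c y -> inv_under (tperm x y) c.
Proof. by move=> cxy z; case: tpermP => // ->. Qed.

Lemma inv_underM (T : Type) s1 s2 (c : D -> T) :
  inv_under s1 c -> inv_under s2 c -> inv_under (s1 * s2) c.
Proof. by move=> c1 c2 z; rewrite permM c2 c1. Qed.

Lemma inv_underV (T : Type) s (c : D -> T) : inv_under s c -> inv_under s^-1 c.
Proof. by move=> cs z; rewrite -{2}(permKV s z) cs. Qed.

Lemma tpermMK x y s : tperm x y * (tperm x y * s) = s.
Proof. by rewrite mulgA tperm2 mul1g. Qed.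

Lemma card_porbits_split s x y :
  x \in porbit s y -> x != y -> #|porbits (tperm x y * s)| = #|porbits s|.+1.
Proof. by move=> xy neq; have /= := porbits_mul_tperm s x y; rewrite xy neq; lia. Qed.

Lemma card_porbits_merge s x y :
  x \notin porbit s y ->
  (#|porbits (tperm x y * s)|).+1 = #|porbits s| /\
  x \in porbit (tperm x y * s) y.
Proof.
move=> xy; have neq : x != y.
  by apply: contraNneq xy => ->; apply: porbit_id.
have /= E1 := porbits_mul_tperm s x y.
have /= := porbits_mul_tperm (tperm x y * s) x y.
rewrite tpermMK; move: E1; rewrite xy neq /=.
by case: (x \in porbit _ y) => /= *; split=> //; lia.
Qed.

Lemma card_porbitsJ s u : #|porbits (s ^ u)| = #|porbits s|.
Proof.
have le s1 u1 : #|porbits (s1 ^ u1)| <= #|porbits s1|.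
  suff -> : porbits (s1 ^ u1) = [set u1 @: A | A : {set D} in porbits s1].
    exact: leq_imset_card.
  have porbJ x : porbit (s1 ^ u1) (u1 x) = u1 @: porbit s1 x.
    apply/setP => y; apply/porbitP/imsetP => [[i ->]|[_ /porbitP[i ->] ->]].
      by exists ((s1 ^+ i) x); rewrite ?mem_porbit // -conjXg permJ.
    by exists i; rewrite -conjXg permJ.
  apply/setP => A; apply/imsetP/imsetP => [[x _ ->]|[_ /imsetP[x _ ->] ->]].
    exists (porbit s1 (u1^-1 x)); first exact: imset_f.
    by rewrite -porbJ permKV.
  by exists (u1 x); rewrite ?porbJ.
apply/eqP; rewrite eqn_leq le /=.
by rewrite -{1}(conjgK u s) le.
Qed.

Lemma planar_hypermapC e n : planar_hypermap e n -> planar_hypermap n e.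
Proof.
move=> pl T c cn ce; rewrite [#|porbits n| + _]addnC.
have -> : n * e = (e * n) ^ e by rewrite conjgE -!mulgA mulKg.
by rewrite card_porbitsJ; apply: pl.
Qed.

(** Splitting an [e]-orbit adds one to its count, while the transposition changes the number of
    faces by one. If two faces merge, the sum of orbit counts is unchanged and [c x = c y] still
    holds; if a face splits, the sum grows by two, which pays for at most one new component. *)
Lemma planar_split e n x y :
  planar_hypermap e n -> x \in porbit e y -> x != y ->
  planar_hypermap (tperm x y * e) n.
Proof.
move=> pl xey neq T c ce cn.
have cte z : c (e z) = c (tperm x y z) by rewrite -[RHS]ce permM tpermK.
rewrite card_porbits_split // -mulgA.
have [xf|xf] := boolP (x \in porbit (e * n) y); last first.
  have [/esym EZ xf'] := card_porbits_merge xf.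
  have cf : inv_under (tperm x y * (e * n)) c by rewrite mulgA; apply: inv_underM.
  have cxy : c x = c y := inv_under_porbit cf xf'.
  have /(pl _ c)/(_ cn) : inv_under e c.
    by move=> z; rewrite cte (inv_under_tperm cxy).
  by rewrite EZ addnS !addSn.
rewrite card_porbits_split //.
(* Identifying the values at [x] and [y] makes the labelling invariant under the old [e] and loses
   at most one value. *)
pose m v := if v == c x then c y else v.
have mxy : m (c x) = m (c y) by rewrite /m eqxx; case: eqP.
have me : inv_under e (m \o c).
  by move=> z; rewrite /= cte; case: tpermP => // ->.
have mn : inv_under n (m \o c) by move=> z; rewrite /= cn.
have arith d l l1 a b k : l <= l1.+1 -> d + 2 * l1 <= a + b + k ->
  d + 2 * l <= a.+1 + b + k.+1 by lia.
apply: arith (pl _ _ me mn).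
rewrite -add1n -(cards1 (c x)); apply: leq_trans (leq_card_setU _ _).
apply/subset_leq_card/subsetP => _ /imsetP[z _ ->]; rewrite !inE.
have [//|ne /=] := eqVneq (c z) (c x).
by apply/imsetP; exists z => //; rewrite /= /m (negPf ne).
Qed.

(** This is edge contraction: the two transpositions cancel in the product, so faces are untouched,
    one [e]-orbit splits and two [n]-orbits merge. *)
Lemma planar_merge e n x y :
  planar_hypermap e n -> x \in porbit e y -> x \notin porbit n y ->
  planar_hypermap (e * tperm x y) (tperm x y * n).
Proof.
move=> pl xey xny T c ce cn.
have neq : x != y by apply: contraNneq xny => ->; apply: porbit_id.
have [/esym EZ xn'] := card_porbits_merge xny.
have cxy : c x = c y := inv_under_porbit cn xn'.
have ct := inv_under_tperm cxy.
have ce0 : inv_under e c.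
  rewrite -[e](mulgK (tperm x y)); apply: inv_underM => //.
  by rewrite tpermV.
have cn0 : inv_under n c by rewrite -(tpermMK x y n); apply: inv_underM.
have := pl _ _ ce0 cn0.
rewrite -[e * _ * _]mulgA tpermMK.
have -> : e * tperm x y = (tperm x y * e) ^ tperm x y.
  by rewrite conjgE tpermV -mulgA tpermMK.
rewrite card_porbitsJ card_porbits_split // EZ.
by rewrite addSn addnS.
Qed.

End Hypermaps.

(** * Counting and summing over the orbits of a permutation *)

Section PorbitSums.
Variables (D : finType) (s : {perm D}).

Lemma partition_porbits : partition (porbits s) [set: D].
Proof.
have -> : porbits s = preim_partition (porbit s) [set: D].
  apply/setP => A; apply/imsetP/imsetP => -[x _ ->]; exists x; rewrite ?inE //.
    by apply/setP => y; rewrite !inE eq_sym eq_porbit_mem.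
  by apply/setP => y; rewrite !inE eq_sym eq_porbit_mem.
exact: preim_partitionP.
Qed.

Lemma sum_porbits (M : nmodType) (F : D -> M) :
  (\sum_x F x = \sum_(A in porbits s) \sum_(x in A) F x)%R.
Proof.
have /and3P[/eqP cov triv _] := partition_porbits.
rewrite -big_trivIset // cov.
by apply: eq_bigl => x; rewrite inE.
Qed.

Lemma card_sum_porbits : #|D| = \sum_(A in porbits s) #|A|.
Proof. by rewrite -(card_partition partition_porbits) cardsT. Qed.

End PorbitSums.

Lemma card_porbits_involution (D : finType) (e : {perm D}) :
  (forall x, e x != x) -> 2 * #|porbits e| <= #|D|.
Proof.
move=> ne; rewrite (card_sum_porbits e) mulnC -sum_nat_const.
apply: leq_sum => _ /imsetP[x _ ->].
have <- : #|[set x; e x]| = 2 by rewrite cards2 eq_sym ne.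
by apply/subset_leq_card/subsetP => y /set2P[] ->; rewrite ?porbit_id // (mem_porbit e 1).
Qed.

(** * Contractions and deletions of edges in a labelled hypermap *)

Section MinorRotation.
Variables (V : finType) (adj : rel V) (D : finType) (lab : D -> option V).
Implicit Types (e n : {perm D}) (x y z : D) (u v : V).
Local Open Scope group_scope.

Definition has_links e := forall u v, adj u v ->
  exists2 x, lab x = Some u & lab (e x) = Some v.

(** Connectedness of a label class is phrased with cuts because this form survives contraction: once
    [n]-orbits merge, fewer sets are closed under [n]. *)
Definition class_connected e n := forall (S : {set D}) u x y,
  inv_under n (mem S) -> lab x = Some u -> lab y = Some u ->
  x \in S -> y \notin S ->
  exists z, [/\ z \in S, e z \notin S, lab z = Some u & lab (e z) = Some u].

Lemma involution_porbit e x : x \in porbit e (e x).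
Proof. by rewrite porbit_sym (mem_porbit e 1). Qed.

(** Each contraction of an edge between two [n]-orbits of one class lowers the number of [n]-orbits
    and leaves the two darts fixed by [e]. When no such edge remains, the cut condition applied to
    an [n]-orbit shows that it fills its class. *)
Lemma contract_classes e n :
  planar_hypermap e n -> involutive e -> inv_under n lab ->
  class_connected e n -> has_links e ->
  exists e' n', [/\ planar_hypermap e' n', involutive e', inv_under n' lab, has_links e'
    & forall x y u, lab x = Some u -> lab y = Some u -> y \in porbit n' x].
Proof.
have [k] := ubnP #|porbits n|; elim: k e n => // k IHk e n; rewrite ltnS => le_k.
move=> pl ee nlab conn links.
have [/existsP[x /and3P[labx /eqP labe xn]]|none] :=
  boolP [exists x, [&& lab x != None, lab (e x) == lab x & x \notin porbit n (e x)]];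
  last first.
  exists e, n; split=> // x y u labx laby; apply: contraT => yx.
  have [|z [zx ezx labz labez]] :=
      conn (porbit n x) u x y _ labx laby (porbit_id _ _) yx.
    by move=> z; rewrite !inE -!eq_porbit_mem (porbit_perm n 1).
  case/existsP: none; exists z; rewrite labz labez eqxx /=.
  by apply: contraNN ezx; rewrite -!eq_porbit_mem in zx * => /eqP <-.
have e'E z : (e * tperm x (e x)) z = if z \in [set x; e x] then z else e z.
  rewrite !inE permM; case: eqP => [->|/eqP zx]; first by rewrite tpermR.
  case: eqP => [->|/eqP zex]; first by rewrite ee tpermL.
  rewrite tpermD //; last by rewrite (inj_eq perm_inj) eq_sym.
  by rewrite -[X in X != _]ee (inj_eq perm_inj) eq_sym.
apply: (IHk (e * tperm x (e x)) (tperm x (e x) * n)).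
- by have [? _] := card_porbits_merge xn; rewrite -ltnS in le_k; lia.
- by apply: planar_merge; rewrite ?involution_porbit.
- move=> z; rewrite !e'E; have [zin|/negP zin] := boolP (z \in _); first by rewrite zin.
  rewrite ifN ?ee //; apply/negP; apply: contra_not zin; rewrite !inE.
  by case/orP => /eqP; [move=> <-; rewrite ee eqxx orbT | move/perm_inj => ->; rewrite eqxx].
- by apply: inv_underM => //; apply: inv_under_tperm.
- move=> S u y z nS laby labz Sy Sz.
  (* A set closed under the merged rotation cannot separate [x] from [e x], so the edge crossing it
     is not the contracted one. *)
  have xex : (x \in S) = (e x \in S).
    exact: (inv_under_porbit nS (card_porbits_merge xn).2).
  have nS0 : inv_under n (mem S).
    by rewrite -(tpermMK x (e x) n); apply: inv_underM => //; apply: inv_under_tperm.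
  have [w [Sw Sew labw labew]] := conn S u y z nS0 laby labz Sy Sz.
  exists w; rewrite e'E ifN //; apply: contraNN Sew; rewrite !inE.
  by case/orP=> /eqP wE; move: Sw; rewrite wE ?ee xex.
- move=> u v uv; have [z labz labez] := links u v uv.
  exists z => //; rewrite e'E; case: ifP => //.
  by rewrite !inE => /orP[] /eqP zE; rewrite -labez zE ?ee labe.
Qed.

Variable good : pred D.

(** Composing [e] with the transposition of [x] and [e x] turns both darts into fixed points, and
    [planar_split] preserves planarity. *)
Lemma delete_edges e n :
  planar_hypermap e n -> involutive e -> {mono e : x / good x} ->
  exists e', [/\ planar_hypermap e' n, involutive e',
    {in good, e' =1 e} & forall x, ~~ good x -> e' x = x].
Proof.
have [k] := ubnP #|[set x | ~~ good x & e x != x]|.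
elim: k e => // k IHk e; rewrite ltnS => le_k pl ee eg.
have [/existsP[x /andP[gx ex]]|none] := boolP [exists x, ~~ good x && (e x != x)];
  last first.
  exists e; split=> // x gx; apply/eqP; apply: contraNT none => ex.
  by apply/existsP; exists x; rewrite gx.
have e'E z : (tperm x (e x) * e) z = if z \in [set x; e x] then z else e z.
  rewrite !inE permM; case: eqP => [->|/eqP zx]; first by rewrite tpermL ee.
  case: eqP => [->|/eqP zex]; first by rewrite tpermR.
  by rewrite tpermD // eq_sym.
have [||||e' [pl' ee' e'g e'j]] := IHk (tperm x (e x) * e).
- apply: leq_trans le_k; apply/proper_card/properP; split.
    apply/subsetP => z; rewrite !inE e'E => /andP[->]; case: ifP => //.
    by rewrite eqxx.
  by exists x; rewrite !inE ?gx ?ex //= e'E !inE eqxx eqxx.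
- by apply: planar_split; rewrite ?involution_porbit // eq_sym.
- move=> z; rewrite !e'E; have [zin|/negP zin] := boolP (z \in _); first by rewrite zin.
  rewrite ifN ?ee //; apply/negP; apply: contra_not zin; rewrite !inE.
  by case/orP => /eqP; [move=> <-; rewrite ee eqxx orbT | move/perm_inj => ->; rewrite eqxx].
- by move=> z; rewrite e'E; case: ifP => // _; apply: eg.
exists e'; split=> // z gz; rewrite e'g // e'E ifN // !inE.
by apply/norP; split; apply: contraTneq gz => ->; rewrite -?topredE /= ?eg.
Qed.

(** A bad dart [x] is bypassed by sending its [n]-predecessor to its [n]-successor and fixing [x];
    this is [planar_split] with the roles of [e] and [n] exchanged. *)
Lemma skip_darts e n :
  planar_hypermap e n -> inv_under n lab -> (forall x, ~~ good x -> e x = x) ->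
  (forall x y u, lab x = Some u -> lab y = Some u -> y \in porbit n x) ->
  exists n', [/\ planar_hypermap e n', inv_under n' lab, 
    forall x, ~~ good x -> n' x = x &
    forall x y u, good x -> good y -> lab x = Some u -> lab y = Some u ->
      y \in porbit n' x].
Proof.
move=> pl nlab ej orb.
(* Transitivity on the good darts of a class is stated through invariant functions: one for the new
   rotation becomes one for the old rotation once its value at the bypassed dart is redefined as the
   value at the predecessor. *)
pose trans n := forall (T : Type) (c : D -> T) x y u, inv_under n c ->
  good x -> good y -> lab x = Some u -> lab y = Some u -> c x = c y.
suff [n' [pl' n'lab n'j n'tr]] : exists n', [/\ planar_hypermap e n',
    inv_under n' lab, forall x, ~~ good x -> n' x = x & trans n'].
  exists n'; split=> // x y u gx gy lx ly; rewrite -eq_porbit_mem.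
  by apply/eqP/(n'tr _ (porbit n') y x u) => // z; apply: (porbit_perm n' 1).
have : trans n.
  by move=> T c x y u nc _ _ lx ly; apply/esym/(inv_under_porbit nc)/(orb _ _ u).
have [k] := ubnP #|[set x | ~~ good x & n x != x]|.
elim: k n pl nlab {orb} => // k IHk n pl nlab; rewrite ltnS => le_k tr.
have [/existsP[x /andP[gx nx]]|none] := boolP [exists x, ~~ good x && (n x != x)];
  last first.
  exists n; split=> // x gx; apply/eqP; apply: contraNT none => ex.
  by apply/existsP; exists x; rewrite gx.
pose t := tperm (n^-1 x) x.
have nVx : n^-1 x != x by apply: contra nx => /eqP {1}<-; rewrite permKV.
have n'x : (t * n) x = x by rewrite permM tpermR permKV.
have n'E z : z != x -> n z != x -> (t * n) z = n z.
  move=> zx nzx; rewrite permM tpermD // 1?eq_sym //.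
  by apply: contra nzx => /eqP ->; rewrite permKV.
apply: (IHk (t * n)).
- apply/planar_hypermapC/planar_split => //; first exact: planar_hypermapC.
  by rewrite porbit_sym -{1}(permKV n x) (mem_porbit n 1).
- apply: inv_underM => //; apply: inv_under_tperm.
  by rewrite (inv_underV nlab).
- apply: leq_trans le_k; apply/proper_card/properP; split.
    apply/subsetP => z; rewrite !inE => /andP[-> n'z] /=.
    apply: contra n'z => /eqP nz; rewrite n'E ?nz //.
      by apply: contraNneq nx => <-; rewrite nz.
    by apply: contraNneq nx => <-; rewrite nz.
  by exists x; rewrite !inE ?gx ?nx //= n'x eqxx.
move=> T c y z u cn' gy gz ly lz.
pose c2 w := if w == x then c (n^-1 x) else c w.
have ne w : good w -> w == x = false by apply: contraTF => /eqP ->.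
suff : c2 y = c2 z by rewrite /c2 !ne.
apply: tr ly lz => // w; rewrite /c2.
case: eqP => [nw|/eqP nw]; case: eqP => [wx|/eqP wx] //.
- by rewrite -nw permK.
- by rewrite wx -(cn' (n^-1 x)) permM tpermL.
by rewrite -(n'E w) // cn'.
Qed.

End MinorRotation.

(** * Restriction to the retained darts, and rotation systems of minors *)

Section SubtypePerm.
Variables (D : finType) (good : pred D).
Local Open Scope group_scope.

Lemma sub_perm (s : {perm D}) : (forall x, ~~ good x -> s x = x) ->
  exists s' : {perm {x | good x}}, (forall x, val (s' x) = s (val x)) /\
    #|porbits s| <= #|porbits s'| + #|[set x | ~~ good x]|.
Proof.
move=> sj.
have gs x : good (s x) = good x.
  have [gx|gx] := boolP (good x); last by rewrite sj // (negPf gx).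
  case gsx: (good (s x)) => //.
  by move: gx; rewrite -(perm_inj (sj (s x) (negbT gsx))) gsx.
have gsx : forall y : {z | good z}, good (s (val y)) by move=> y; rewrite gs (valP y).
pose f := fun y : {z | good z} => (Sub (s (val y)) (gsx y) : {z | good z}).
have f_inj : injective f by move=> x y /(congr1 val) /= /perm_inj /val_inj.
exists (perm f_inj); split=> [x|]; first by rewrite permE.
have valE i (x : {z | good z}) : val ((perm f_inj ^+ i) x) = (s ^+ i) (val x).
  by elim: i => [|i IHi]; rewrite ?perm1 // !expgSr !permM permE /= IHi.
rewrite -(card_imset _ (@set1_inj D)).
apply: leq_trans (leq_add (leq_imset_card (fun A : {set _} => val @: A) _) (leqnn _)).
apply: leq_trans (leq_card_setU _ _); apply/subset_leq_card/subsetP.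
move=> _ /imsetP[x _ ->]; rewrite inE; apply/orP.
have [gx|gx] := boolP (good x); [left|right]; last first.
  apply/imsetP; exists x; rewrite ?inE //; apply/setP => y; rewrite inE.
  apply/porbitP/eqP => [[i ->]|->]; last by exists 0; rewrite perm1.
  by elim: i => [|i IHi]; rewrite ?perm1 // expgSr permM IHi sj.
apply/imsetP; exists (porbit (perm f_inj) (Sub x gx)); first exact: imset_f.
apply/setP => y; apply/porbitP/imsetP => [[i ->]|[_ /porbitP[i ->] ->]].
  by exists ((perm f_inj ^+ i) (Sub x gx)); rewrite ?mem_porbit // valE.
by exists i; rewrite valE.
Qed.

End SubtypePerm.

(* A spherical embedding of the graph: D is the set of darts, e reverses a dart,
   n turns around its source, and the orbits of e * n are the faces. *)
Record rotation_system (V : finType) (adj : rel V) (D : finType) (src : D -> V)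
    (e n : {perm D}) : Prop := RotationSystem {
  rs_inv : involutive e;
  rs_adj : forall x, adj (src x) (src (e x));
  rs_inj : forall x y, src x = src y -> src (e x) = src (e y) -> x = y;
  rs_surj : forall u v, adj u v -> exists2 x, src x = u & src (e x) = v;
  rs_src : forall x, src (n x) = src x;
  rs_orb : forall x y, src x = src y -> y \in porbit n x;
  rs_euler : 0 < #|D| -> #|D| + 4 <= 2 * (#|porbits n| + #|porbits (e * n)%g|) }.

(** Classes are contracted to single orbits, one pair of opposite darts per edge is retained, all
    other edges are deleted, and the hypermap is restricted to the retained darts. *)
Lemma minor_rotation (V : finType) (adj : rel V) (D : finType) (lab : D -> option V)
    (e n : {perm D}) :
  symmetric adj -> irreflexive adj ->
  planar_hypermap e n -> involutive e -> inv_under n lab ->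
  class_connected lab e n -> has_links adj lab e ->
  exists (D' : finType) (src : D' -> V) (e' n' : {perm D'}),
    rotation_system adj src e' n'.
Proof.
move=> adjC adj_irr pl0 ee0 nlab0 conn links0.
have [e1 [n1 [pl1 ee1 nlab1 links1 orb1]]] := contract_classes pl0 ee0 nlab0 conn links0.
pose pickd u v := [pick x | (lab x == Some u) && (lab (e1 x) == Some v)].
have pickdP u v x : pickd u v = Some x -> lab x = Some u /\ lab (e1 x) = Some v.
  by rewrite /pickd; case: pickP => // y /andP[/eqP ? /eqP ?] [<-].
(* The order of the ranks selects one direction of each edge, so that the two directions cannot pick
   two parallel links. *)
pose good x := [exists u, [exists v, [&& adj u v, enum_rank u < enum_rank v &
  (pickd u v == Some x) || (pickd u v == Some (e1 x))]]].
have goodP x : good x -> exists u v, [/\ adj u v, enum_rank u < enum_rank v &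
    pickd u v = Some x \/ pickd u v = Some (e1 x)].
  case/existsP => u /existsP[v /and3P[uv luv /orP dx]]; exists u, v; split=> //.
  by case: dx => /eqP; [left|right].
have goodI u v x : adj u v -> enum_rank u < enum_rank v ->
    pickd u v = Some x \/ pickd u v = Some (e1 x) -> good x.
  move=> uv luv dx; apply/existsP; exists u; apply/existsP; exists v.
  by rewrite uv luv /=; case: dx => ->; rewrite eqxx ?orbT.
have goode : {mono e1 : x / good x}.
  have im x : good x -> good (e1 x).
    move=> /goodP[u [v [uv luv dx]]]; apply: (goodI u v) => //.
    by rewrite ee1; case: dx; [right|left].
  by move=> x; apply/idP/idP => /im //; rewrite ee1.
have good_adj x : good x -> exists u v, [/\ lab x = Some u, lab (e1 x) = Some v & adj u v].
  move=> /goodP[u [v [uv luv []]]] /pickdP[]; first by exists u, v.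
  by rewrite ee1; exists v, u; rewrite adjC.
have good_inj x y : good x -> good y -> lab x = lab y -> lab (e1 x) = lab (e1 y) -> x = y.
  move=> /goodP[u [v [_ luv dx]]] /goodP[u' [v' [_ luv' dy]]] lxy lexy.
  have [Ex|Ex] := dx; have [Ey|Ey] := dy; have [] := pickdP _ _ _ Ex; have [] := pickdP _ _ _ Ey;
    rewrite ?ee1 ?lxy ?lexy => -> -> [E1] [E2]; subst.
  - by move: Ex; rewrite Ey => -[].
  - by have := ltn_trans luv luv'; rewrite ltnn.
  - by have := ltn_trans luv luv'; rewrite ltnn.
  - by move: Ex; rewrite Ey => -[] /perm_inj.
have good_surj u v : adj u v -> exists x, [/\ good x, lab x = Some u & lab (e1 x) = Some v].
  have main u' v' : adj u' v' -> enum_rank u' < enum_rank v' ->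
      exists x, [/\ good x, lab x = Some u' & lab (e1 x) = Some v'].
    move=> uv luv; have [x lx lex] := links1 u' v' uv.
    case Ed: (pickd u' v') => [y|].
      by have [] := pickdP _ _ _ Ed; exists y; split=> //; apply: goodI uv luv _; left.
    by move: Ed; rewrite /pickd; case: pickP => // /(_ x); rewrite lx lex !eqxx.
  move=> uv; case: (ltngtP (enum_rank u) (enum_rank v)) => [|lvu|/val_inj/enum_rank_inj E].
  - exact: main.
  - rewrite adjC in uv; have [x [gx lx lex]] := main _ _ uv lvu.
    by exists (e1 x); rewrite goode ee1.
  - by rewrite E adj_irr in uv.
have [e2 [pl2 ee2 e2g e2j]] := delete_edges pl1 ee1 goode.
have [n2 [pl3 n2lab n2j orb2]] := skip_darts pl2 nlab1 e2j orb1.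
have [e3 [e3E le_e]] := sub_perm e2j.
have [n3 [n3E le_n]] := sub_perm n2j.
have fj x : ~~ good x -> (e2 * n2)%g x = x by move=> gx; rewrite permM e2j ?n2j.
have [f3 [f3E le_f]] := sub_perm fj.
have Ef : f3 = (e3 * n3)%g.
  by apply/permP => x; apply: val_inj; rewrite f3E !permM n3E e3E.
have [src srcE] : exists src : {x | good x} -> V, forall x, lab (val x) = Some (src x).
  apply: (@fin_all_exists _ (fun=> V) (fun x u => lab (val x) = Some u)) => x.
  by have [u [v []]] := good_adj _ (valP x); exists u.
have e3E1 x : val (e3 x) = e1 (val x) by rewrite e3E e2g //; apply: valP.
have src_adj x : adj (src x) (src (e3 x)).
  have [u [v []]] := good_adj _ (valP x); rewrite -e3E1 !srcE.
  by move=> [->] [->].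
exists {x | good x}, src, e3, n3; split=> //.
- by move=> x; apply: val_inj; rewrite !e3E1 ee1.
- move=> x y sxy sexy; apply/val_inj/good_inj; rewrite ?srcE -?e3E1 ?srcE ?sxy ?sexy //.
    exact: valP.
  exact: valP.
- move=> u v uv; have [x [gx lx lex]] := good_surj u v uv.
  exists (Sub x gx); apply: Some_inj; rewrite -srcE ?e3E1 SubK //.
- by move=> x; apply: Some_inj; rewrite -!srcE n3E n2lab.
- move=> x y sxy; have := orb2 (val x) (val y) (src x) (valP x) (valP y).
  rewrite !srcE sxy => /(_ erefl erefl) /porbitP[i yE].
  apply/porbitP; exists i; apply: val_inj; rewrite yE.
  by elim: i {yE} => [|i IHi]; rewrite ?perm1 // !expgSr !permM IHi n3E.
move=> D_gt0.
(* Every bad dart is a component of its own and an orbit of all three permutations, so it cancels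
   from the inequality; the good darts share one further component, which yields the constant in
   Euler's formula. *)
pose c x := if good x then None else Some x.
have ce : inv_under e2 c.
  move=> x; rewrite /c; have [gx|gx] := boolP (good x); last by rewrite e2j // (negPf gx).
  by rewrite e2g // goode gx.
have cn : inv_under n2 c.
  move=> x; rewrite /c; have [gx|gx] := boolP (good x); last by rewrite n2j // (negPf gx).
  have [//|gnx] := boolP (good (n2 x)).
  by move: (gnx); rewrite (perm_inj (n2j _ gnx)) gx.
have := pl3 _ _ ce cn.
have cardD : #|D| = #|{: {x | good x}}| + #|[set x | ~~ good x]|.
  by rewrite card_sig cardsE -(cardC good).
have cardc : #|[set x | ~~ good x]|.+1 <= #|c @: D|.
  have [x _] := card_gt0P D_gt0.
  rewrite -(card_imset [set x | ~~ good x] (@Some_inj _)) -add1n -(cards1 (None : option D)).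
  rewrite -cardsUI (_ : _ :&: _ = set0) ?cards0 ?addn0; last first.
    by apply/setP => o; rewrite !inE; case: eqP => // ->; apply/imsetP => -[].
  apply/subset_leq_card/subsetP => o /setUP[/set1P ->|/imsetP[y gy ->]].
    by apply/imsetP; exists (val x); rewrite // /c (valP x).
  by apply/imsetP; exists y; rewrite // /c; move: gy; rewrite inE => /negPf ->.
have le_e3 : 2 * #|porbits e3| <= #|{: {x | good x}}|.
  apply: card_porbits_involution => x; apply/negP => /eqP ex.
  by have := src_adj x; rewrite ex adj_irr.
have arith d2 d3 j c2 pe pn pf qe qn qf : pe <= qe + j -> pn <= qn + j -> pf <= qf + j ->
    d2 = d3 + j -> j.+1 <= c2 -> 2 * qe <= d3 -> d2 + 2 * c2 <= pe + pn + pf ->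
  d3 + 4 <= 2 * (qn + qf) by lia.
by rewrite -Ef; apply: arith le_e le_n le_f cardD cardc le_e3.
Qed.

(** An invariant function factors through the orbits. The orbit counts of the grid are bounded below
    in this way, without describing the orbits. *)
Lemma leq_imset_porbits (D T : finType) (s : {perm D}) (c : D -> T) :
  inv_under s c -> #|c @: D| <= #|porbits s|.
Proof.
move=> cs; have [/eqP E|[x0 _]] := set_0Vmem [set: D].
  rewrite (_ : c @: D = set0) ?cards0 //; apply/setP => t; rewrite inE.
  by apply/negP => /imsetP[x]; move/eqP/setP/(_ x): E; rewrite !inE.
pose g (A : {set D}) := c (odflt x0 [pick x in A]).
apply: leq_trans (leq_imset_card g _); apply/subset_leq_card/subsetP => _ /imsetP[x _ ->].
apply/imsetP; exists (porbit s x); first exact: imset_f.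
rewrite /g; case: pickP => [y|/(_ x)]; last by rewrite porbit_id.
by move=> yx; apply/esym/(inv_under_porbit cs).
Qed.

(** * The planar hypermap of a square grid *)

Section Grid.
Variable m : nat.
Notation I := ('I_m.+1).

Definition can_step (p : bool) (i : I) := if p then i < m else 0 < i.
Definition step (p : bool) (i : I) : I := inord (if p then i.+1 else i.-1).

Lemma val_step p i : can_step p i -> step p i = (if p then i.+1 else i.-1) :> nat.
Proof. by case: p => /= ci; rewrite inordK //; case: i ci => i /=; lia. Qed.

Lemma can_stepN p i : can_step p i -> can_step (~~ p) (step p i).
Proof. by move=> ci; rewrite /can_step val_step //; case: p ci => //=; case: i => i /=; lia. Qed.

Lemma stepK p i : can_step p i -> step (~~ p) (step p i) = i.
Proof.
move=> ci; apply/val_inj; rewrite /= val_step ?can_stepN // val_step //.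
by case: p ci => //=; case: i => i /=; lia.
Qed.

(* A dart of the grid is a cell with a side; the side (h, p) is east, north, west,
   south for (true, true), (false, true), (true, false), (false, false). *)
Definition dart := ((I * I) * (bool * bool))%type.

(** A dart pointing out of the grid has no opposite and is fixed. *)
Definition dart_opp (x : dart) : dart :=
  let: ((i, j), (h, p)) := x in
  if h then if can_step p i then ((step p i, j), (h, ~~ p)) else x
  else if can_step p j then ((i, step p j), (h, ~~ p)) else x.

Definition dart_rot (x : dart) : dart :=
  let: (c, (h, p)) := x in (c, (~~ h, if h then p else ~~ p)).

Lemma dart_oppK : involutive dart_opp.
Proof.
case=> -[i j] [[] p] /=; case: ifP => ci /=; rewrite ?ci ?can_stepN ?stepK ?negbK //.
Qed.

Lemma dart_rot_inj : injective dart_rot.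
Proof. by case=> c [[] []] [c' [[] []]] //= [->]. Qed.

Definition grid_e := perm (inv_inj dart_oppK).
Definition grid_n := perm dart_rot_inj.

Lemma inv_grid_n (T : Type) (c : dart -> T) a d1 d2 :
  inv_under grid_n c -> c (a, d1) = c (a, d2).
Proof.
move=> cn; have H h p : c (a, (~~ h, if h then p else ~~ p)) = c (a, (h, p)).
  by rewrite -[RHS]cn permE.
suff H2 d : c (a, d) = c (a, (true, true)) by rewrite !H2.
move: (H true true) (H false true) (H true false) => /= H3 H4 H5.
by case: d => -[] []; rewrite ?H5 ?H4 ?H3.
Qed.

Definition cell_adj (a b : I * I) :=
  ((a.1 == b.1) && ((a.2.+1 == b.2) || (b.2.+1 == a.2))) ||
  ((a.2 == b.2) && ((a.1.+1 == b.1) || (b.1.+1 == a.1))).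

Lemma cell_adj_dart a b : cell_adj a b -> exists d, (dart_opp (a, d)).1 = b.
Proof.
case: a b => [i j] [i' j'] /orP[] /= /andP[/eqP -> /orP[]/eqP E].
- have lt := ltn_ord j'; exists (false, true); rewrite /= /can_step ifT /=; last by lia.
  by congr pair; apply/val_inj; rewrite /= inordK; lia.
- have lt := ltn_ord j; exists (false, false); rewrite /= /can_step ifT /=; last by lia.
  by congr pair; apply/val_inj; rewrite /= inordK; lia.
- have lt := ltn_ord i'; exists (true, true); rewrite /= /can_step ifT /=; last by lia.
  by congr pair; apply/val_inj; rewrite /= inordK; lia.
- have lt := ltn_ord i; exists (true, false); rewrite /= /can_step ifT /=; last by lia.
  by congr pair; apply/val_inj; rewrite /= inordK; lia.
Qed.

Lemma grid_const (T : Type) (c : dart -> T) :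
  inv_under grid_e c -> inv_under grid_n c -> forall x y, c x = c y.
Proof.
move=> ce cn.
suff H x : c x = c ((ord0, ord0), (true, true)) by move=> x y; rewrite !H.
case: x => -[i j] d; move Ek: (i + j) => k; elim: k i j d Ek => [|k IHk] i j d Ek.
  have [-> ->] : i = ord0 /\ j = ord0 by split; apply/val_inj => /=; lia.
  exact: inv_grid_n.
have [i0|i_gt0] := posnP i.
  rewrite (inv_grid_n _ d (false, false) cn) -ce permE /= ifT; last by lia.
  by apply: IHk; rewrite val_step /=; lia.
rewrite (inv_grid_n _ d (true, false) cn) -ce permE /= i_gt0.
by apply: IHk; rewrite val_step //=; lia.
Qed.

Definition dart_wall (x : dart) : bool * ('I_m.+2 * I) :=
  let: ((i, j), (h, p)) := x in
  (h, if h then (inord (i + p), j) else (inord (j + p), i)).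

(** The corner at the clockwise end of the side labels the face of the dart; all corners on the
    border of the grid receive [None], for the outer face. *)
Definition dart_corner (x : dart) : option (I * I) :=
  let: ((i, j), (h, p)) := x in let a := i + p in let b := j + (h (+) p) in
  if [&& 0 < a, a <= m, 0 < b & b <= m] then Some (inord a, inord b) else None.

Lemma inv_dart_wall : inv_under grid_e dart_wall.
Proof.
case=> -[i j] [[] p]; rewrite permE /=; case: ifP => //= ci;
  rewrite val_step //; case: p ci => //= ci; do 2! congr pair; congr inord; lia.
Qed.

Lemma inv_dart_corner : inv_under (grid_e * grid_n)%g dart_corner.
Proof.
case=> -[i j] [[] p]; rewrite permM !permE /=; case: ifP => /= ci; rewrite ?val_step //.
all: case: p ci => /= ci; case: i j ci => [i Hi] [j Hj] /= ci.
all: case: ifP => C1; case: ifP => C2 //; try lia.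
all: congr (Some (inord _, inord _)); lia.
Qed.

(** The grid is connected, so there is at most one component. Cells, walls and corners supply at
    least [(m+1)^2], [2(m+2)(m+1)] and [m^2+1] orbits, which add up exactly to [4(m+1)^2 + 2]. *)
Lemma planar_grid : planar_hypermap grid_e grid_n.
Proof.
move=> T c ce cn.
have c1 : #|c @: {: dart}| <= 1.
  by apply/card_le1_eqP => _ _ /imsetP[x _ ->] /imsetP[y _ ->]; apply: grid_const.
have Zn : m.+1 ^ 2 <= #|porbits grid_n|.
  have cellP : inv_under grid_n (fun x : dart => x.1) by case=> a [h p]; rewrite permE.
  apply: leq_trans (leq_imset_porbits cellP).
  rewrite -[leqLHS](_ : #|[set: I * I]| = _); last by rewrite cardsT card_prod card_ord.
  apply/subset_leq_card/subsetP => a _; apply/imsetP.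
  by exists (a, (true, true)).
have Ze : 2 * (m.+2 * m.+1) <= #|porbits grid_e|.
  apply: leq_trans (leq_imset_porbits inv_dart_wall).
  rewrite -[leqLHS](_ : #|[set: bool * ('I_m.+2 * I)]| = _); last first.
    by rewrite cardsT !card_prod card_bool !card_ord.
  apply/subset_leq_card/subsetP => -[h [[w Hw] j]] _; apply/imsetP.
  exists (if h then ((inord w.-1, j), (h, 0 < w)) else ((j, inord w.-1), (h, 0 < w))) => //.
  case: h; rewrite /= inordK; try lia.
    do 2! congr pair; apply/val_inj; rewrite /= inordK; lia.
  do 2! congr pair; apply/val_inj; rewrite /= inordK; lia.
have Zf : (m * m).+1 <= #|porbits (grid_e * grid_n)|.
  apply: leq_trans (leq_imset_porbits inv_dart_corner).
  pose A := setX [set~ ord0 : I] [set~ ord0 : I].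
  have cardA : #|A| = m * m by rewrite cardsX !cardsC1 card_ord.
  rewrite -cardA -(card_imset A (@Some_inj _)) -add1n -(cards1 (None : option (I * I))).
  rewrite -cardsUI (_ : _ :&: _ = set0) ?cards0 ?addn0; last first.
    by apply/setP => o; rewrite !inE; case: eqP => // ->; apply/imsetP => -[].
  apply/subset_leq_card/subsetP => o /setUP[/set1P ->|/imsetP[[i j] + ->]].
    by apply/imsetP; exists ((ord0, ord0), (false, false)).
  rewrite !inE => /andP[/= i0 j0]; apply/imsetP; exists ((i, j), (false, false)) => //=.
  rewrite !addn0 ifT ?inord_val //.
  move: i0 j0; rewrite -!val_eqE /= => i0 j0.
  by case: i j i0 j0 => [i Hi] [j Hj] /=; lia.
have cardD : #|{: dart}| = 4 * (m.+1 * m.+1) by rewrite !card_prod !card_ord card_bool; lia.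
have arith d k zn ze zf : d = 4 * (m.+1 * m.+1) -> k <= 1 -> m.+1 ^ 2 <= zn ->
  2 * (m.+2 * m.+1) <= ze -> (m * m).+1 <= zf -> d + 2 * k <= ze + zn + zf by nia.
exact: arith cardD c1 Zn Ze Zf.
Qed.

Lemma grid_minor_rotation (V : finType) (adj : rel V) (cls : I * I -> option V) :
  symmetric adj -> irreflexive adj ->
  (forall (S : {set I * I}) u a b, cls a = Some u -> cls b = Some u -> a \in S -> b \notin S ->
    exists c d, [/\ cell_adj c d, c \in S, d \notin S, cls c = Some u & cls d = Some u]) ->
  (forall u v, adj u v -> exists c d, [/\ cell_adj c d, cls c = Some u & cls d = Some v]) ->
  exists (D : finType) (src : D -> V) (e n : {perm D}), rotation_system adj src e n.
Proof.
move=> adjC adj_irr conn links.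
have celln : inv_under grid_n (fun x : dart => cls x.1) by case=> a [h p]; rewrite permE.
apply: (minor_rotation adjC adj_irr planar_grid _ celln).
- by move=> x; rewrite !permE dart_oppK.
- move=> S u [a d1] [b d2] nS /= la lb Sa Sb.
  (* A set closed under the rotation consists of all four darts of certain cells, so one direction
     represents the cell. *)
  pose S' := [set c | (c, (true, true)) \in S].
  have S'E c d : (c \in S') = ((c, d) \in S).
    by rewrite inE; apply: (inv_grid_n _ _ _ nS).
  have [||c1 [c2 [c12 Sc1 Sc2 l1 l2]]] := conn S' u a b la lb.
  - by rewrite (S'E _ d1).
  - by rewrite (S'E _ d2).
  have [d dE] := cell_adj_dart c12.
  exists (c1, d); rewrite permE -(S'E c1 d) dE; split=> //.
  by move: Sc2; rewrite -dE; case: dart_opp => c3 d3; rewrite (S'E _ d3).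
move=> u v uv; have [c1 [c2 [c12 l1 l2]]] := links u v uv.
have [d dE] := cell_adj_dart c12.
by exists (c1, d); rewrite // permE dE.
Qed.

End Grid.

(** * Colourings, critical graphs and recolouring along plain paths *)

Section Colorings.
Variable V : finType.
Implicit Types (adj : rel V) (c : V -> option bool) (u v w t : V).

(* The colour None stands for the third part, where degrees are bounded. *)
Definition proper adj c := forall u v, adj u v -> c u = c v -> c u = None.

Definition defect adj c v := #|[set u | adj v u & c u == None]|.

Definition colorable adj := exists c,
  proper adj c /\ forall v, c v = None -> defect adj c v <= 117.

Definition nbrs adj v := [set u | adj v u].
Definition deg adj v := #|nbrs adj v|.
Definition big adj v := 120 <= deg adj v.

Definition recolor c t k := fun u => if u == t then k else c u.

(* A vertex of the third part with degree at most 119 and at least 118 neighbours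
   in that part can be moved to one of the two independent sets. *)
Lemma weak_colorable adj c : symmetric adj -> irreflexive adj -> proper adj c ->
  (forall v, big adj v -> c v = None -> defect adj c v <= 117) -> colorable adj.
Proof.
move=> adjC adj_irr; have [k] := ubnP #|[set u | c u == None]|.
elim: k c => // k IHk c; rewrite ltnS => le_k c_prop c_weak.
have [/existsP[v /andP[/eqP cv dv]]|none] :=
  boolP [exists v, (c v == None) && (117 < defect adj c v)]; last first.
  exists c; split=> // v cv; rewrite leqNgt; apply: contraNN none => dv.
  by apply/existsP; exists v; rewrite cv eqxx.
have v_small : deg adj v < 120.
  by rewrite ltnNge; apply/negP => /c_weak/(_ cv); rewrite leqNgt dv.
have [b bP] : exists b, forall u, adj v u -> c u != Some b.
  pose N b := [set u | adj v u & c u == Some b].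
  have [E|[u]] := set_0Vmem (N true).
    by exists true => u vu; apply/eqP => cu; have := in_set0 u; rewrite -E inE vu cu eqxx.
  rewrite inE => /andP[vu /eqP cu]; exists false => u' vu'; apply/eqP => cu'.
  have uu' : u != u' by apply/eqP => E; move: cu; rewrite E cu'.
  (* Neighbours in both independent sets would force degree at least 118 + 2, against
     [deg adj v < 120]. *)
  have : defect adj c v + 2 <= deg adj v.
    have <- : #|[set u; u']| = 2 by rewrite cards2 uu'.
    rewrite /defect -cardsUI (_ : _ :&: _ = set0) ?cards0 ?addn0; last first.
      apply/setP => z; rewrite !inE; apply/negP => /andP[/andP[_ /eqP cz] /orP[]/eqP zE].
        by rewrite zE cu in cz.
      by rewrite zE cu' in cz.
    apply/subset_leq_card/subsetP => z; rewrite !inE.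
    by case/orP => [/andP[]|/orP[]/eqP->].
  by lia.
apply: (IHk (recolor c v (Some b))).
- apply: leq_trans le_k; apply/proper_card/properP; split.
    by apply/subsetP => u; rewrite !inE /recolor; case: ifP.
  by exists v; rewrite !inE /recolor ?eqxx ?cv.
- move=> x y xy; rewrite /recolor; case: eqP => [E|_]; case: eqP => [E'|_] //.
  + by move: xy; rewrite E E' adj_irr.
  + by rewrite E in xy => /esym cy; have := bP y xy; rewrite cy eqxx.
  + by rewrite E' adjC in xy => cx; have := bP x xy; rewrite cx eqxx.
  exact: c_prop.
move=> x bx; rewrite {1}/recolor; case: eqP => // _ cx.
apply: leq_trans (c_weak x bx cx); apply/subset_leq_card/subsetP => u.
by rewrite !inE /recolor; case: (u == v); rewrite ?andbF.
Qed.

Definition plain adj v := (deg adj v == 3) && (#|[set u in nbrs adj v | big adj u]| == 1).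
Definition plain_adj adj u v := [&& adj u v, plain adj u & plain adj v].

(** The deleted vertex stays as an isolated one, so the vertex type is fixed and minimality refers
    to edges. *)
Definition del_vertex adj x u v := [&& adj u v, u != x & v != x].

Definition critical adj := [/\ symmetric adj, irreflexive adj, ~ colorable adj &
  forall x v, adj x v -> colorable (del_vertex adj x)].

Section Critical.
Variable adj : rel V.
Hypothesis adj_critical : critical adj.

Let adjC : symmetric adj. Proof. by case: adj_critical. Qed.
Let adj_irr : irreflexive adj. Proof. by case: adj_critical. Qed.
Let adjNcol : ~ colorable adj. Proof. by case: adj_critical. Qed.

Local Notation big := (big adj).
Local Notation plain := (plain adj).
Local Notation deg := (deg adj).
Local Notation defect := (defect adj).

Lemma plain_small v : plain v -> ~~ big v.
Proof. by case/andP => /eqP dv _; rewrite /big dv. Qed.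

Lemma plain_big_uniq v u u' : plain v -> adj v u -> adj v u' -> big u -> big u' -> u = u'.
Proof.
case/andP => _ /cards1P[b bE] vu vu' bu bu'.
have : u \in [set b] by rewrite -bE !inE vu.
have : u' \in [set b] by rewrite -bE !inE vu'.
by rewrite !inE => /eqP -> /eqP ->.
Qed.

(** Otherwise [v] could be deleted and put back into the third part: this raises no defect at a big
    vertex, and [weak_colorable] repairs the small ones. *)
Lemma critical_has_big v u : adj v u -> ~~ big v -> exists2 b, adj v b & big b.
Proof.
move=> vu vsmall; have [/existsP[b /andP[]]|none] := boolP [exists b, adj v b && big b].
  by exists b.
have [_ _ _ /(_ v u vu)[c [c_prop c_def]]] := adj_critical.
case: adjNcol; apply: (@weak_colorable adj (recolor c v None)) => //.
  move=> x y xy; rewrite /recolor; case: eqP => [//|xv]; case: eqP => [//|yv].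
  by apply: c_prop; apply/and3P; split=> //; apply/eqP.
move=> x bx; rewrite {1}/recolor; case: eqP => [E|xv cx]; first by rewrite -E bx in vsmall.
apply: leq_trans (c_def x cx); apply/subset_leq_card/subsetP => y.
rewrite !inE /recolor /del_vertex => /andP[xy]; rewrite xy.
case: (eqVneq y v) => [E _|_ /= ->].
  by case/existsP: none; exists x; rewrite adjC -E xy.
by rewrite !andbT; apply/eqP.
Qed.

(** With at most two neighbours, either an independent set is free for [v], or each contains one
    neighbour; then [v] joins the third part, where it has no neighbour. *)
Lemma critical_deg_ge3 v u : adj v u -> 3 <= deg v.
Proof.
move=> vu; rewrite leqNgt; apply/negP => dv.
have [_ _ _ /(_ v u vu)[c [c_prop c_def]]] := adj_critical.
have [k [kP kdef]] : exists k, (forall x, adj v x -> k <> None -> c x <> k) /\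
    (k = None -> forall x, adj v x -> c x <> None).
  have [/existsP[b /forallP bP]|all_used] :=
      boolP [exists b, forall x, adj v x ==> (c x != Some b)].
    exists (Some b); split=> // x vx _ cx; move: (bP x).
    by rewrite vx cx eqxx.
  exists None; split=> // _ x vx cx.
  have used b : exists2 y, adj v y & c y = Some b.
    move: all_used; rewrite negb_exists => /forallP/(_ b); rewrite negb_forall.
    by case/existsP => y; rewrite negb_imply negbK => /andP[vy /eqP]; exists y.
  have [y1 vy1 cy1] := used true; have [y2 vy2 cy2] := used false.
  suff : 2 < deg v by rewrite ltnNge -ltnS dv.
  have <- : #|x |: [set y1; y2]| = 3.
    have xy1 : x != y1 by apply/eqP => E; rewrite E cy1 in cx.
    have xy2 : x != y2 by apply/eqP => E; rewrite E cy2 in cx.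
    have y12 : y1 != y2 by apply/eqP => E; rewrite E cy2 in cy1.
    by rewrite cardsU1 cards2 !inE negb_or xy1 xy2 y12.
  by apply/subset_leq_card/subsetP => z; rewrite !inE => /or3P[] /eqP ->.
case: adjNcol; apply: (@weak_colorable adj (recolor c v k)) => //.
  move=> x y xy; rewrite /recolor; case: eqP => [E|xv]; case: eqP => [E'|yv] //.
  - by move: xy; rewrite E E' adj_irr.
  - rewrite E in xy => kE; case: k kP {kdef} kE => // b kP kE.
    by case: (kP y xy _ (esym kE)).
  - by rewrite E' adjC in xy => kE; case: k kP {kdef} kE => // b kP kE; case: (kP x xy _ kE).
  by apply: c_prop; apply/and3P; split=> //; apply/eqP.
move=> x bx; rewrite {1}/recolor; case: eqP => [E kN|xv cx].
  by move: bx; rewrite E /big leqNgt (leq_trans dv).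
apply: leq_trans (c_def x cx); apply/subset_leq_card/subsetP => y.
rewrite !inE /recolor /del_vertex => /andP[xy]; rewrite xy.
case: (eqVneq y v) => [E|_ /= ->].
  by move=> /eqP kN; rewrite E adjC in xy; case: (kdef kN x xy).
by rewrite !andbT; apply/eqP.
Qed.

Variable w : V.
Hypothesis w_big : big w.

(* A colouring of all vertices but t, where the bound is not required at w and
   where B contains the neighbours of w that lie in the third part. *)
Definition token_coloring (B : {set V}) c t := [/\
  forall u v, adj u v -> u != t -> v != t -> c u = c v -> c u = None,
  forall v, big v -> v != w -> v != t -> c v = None ->
    #|[set u | [&& adj v u, c u == None & u != t]]| <= 117,
  c w = None & forall u, adj w u -> c u = None -> u != t -> u \in B].

(** The uncoloured vertex moves from [t] to [t']. Of the three neighbours of [t], one is the big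
    vertex [b], one is [t'], and only [s] remains to be avoided. *)
Lemma token_step B c t t' : token_coloring B c t -> plain_adj adj t t' ->
  exists c', token_coloring B c' t'.
Proof.
case=> c_prop c_def cw cB /and3P[tt' pt pt'].
have [b [tb bb tE]] : exists b, [/\ adj t b, big b &
    exists s, forall u, adj t u -> [|| u == b, u == t' | u == s]].
  case/andP: (pt) => /eqP d3 /cards1P[b bE].
  have : b \in [set b] by rewrite inE.
  rewrite -bE !inE => /andP[tb bb]; exists b; split=> //.
  have bt' : b != t' by apply: contraNneq (plain_small pt') => <-.
  have : #|nbrs adj t :\ b :\ t'| = 1.
    have := cardsD1 t' (nbrs adj t :\ b); have := cardsD1 b (nbrs adj t).
    by rewrite -/(deg t) d3 !inE tb tt' eq_sym bt' /=; lia.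
  case/eqP/cards1P => s sE; exists s => u tu.
  have [//|ub /=] := eqVneq u b; have [//|ut' /=] := eqVneq u t'.
  by have : u \in [set s] by [rewrite -sE !inE ub ut' tu]; rewrite inE.
case: tE => s tE.
have wt : w != t by apply: contraTneq w_big => ->; apply: plain_small.
(* If [b] is outside the third part, [t] may join that part without raising a defect at any big
   vertex. If [b] is inside, [t] takes an independent set not containing [s]. *)
have [k [kprop kN]] : exists k : option bool,
    (k = None -> c b <> None) /\ (forall u, adj t u -> u != t' -> c u = k -> k = None).
  have [cb|/eqP cb] := eqVneq (c b) None; last by exists None.
  exists (Some (if c s is Some true then false else true)); split=> // u tu ut'.
  have := tE u tu; rewrite (negPf ut') /= => /orP[]/eqP ->; first by rewrite cb.
  by case: (c s) => [[]|].
exists (recolor c t k); split.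
- move=> u v uv ut' vt'; rewrite /recolor; case: eqP => [E|/eqP ut]; case: eqP => [E'|/eqP vt].
  + by rewrite E E' adj_irr in uv.
  + by rewrite E in uv => /esym; apply: kN.
  + by rewrite E' adjC in uv => /[dup] cu -> ; apply: kN cu.
  exact: c_prop.
- move=> v bv vw vt'; rewrite {1}/recolor; case: eqP => [E|/eqP vt cv].
    by move: bv; rewrite E (negPf (plain_small pt)).
  apply: leq_trans (c_def v bv vw vt cv); apply/subset_leq_card/subsetP => u.
  rewrite !inE /recolor => /and3P[vu + _]; rewrite vu; case: (eqVneq u t) => [E /eqP kE|_ -> //].
  by rewrite E adjC in vu; have := kprop kE; rewrite (plain_big_uniq pt tb vu bb bv) cv.
- by rewrite /recolor (negPf wt).
move=> u wu; rewrite /recolor; case: eqP => [E kE|/eqP ut cu ut']; last exact: cB.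
rewrite E adjC in wu; have := kprop kE.
by rewrite (plain_big_uniq pt tb wu bb w_big) cw.
Qed.

Lemma token_path B c t p : token_coloring B c t -> path (plain_adj adj) t p ->
  exists c', token_coloring B c' (last t p).
Proof.
elim: p c t => [|t' p IHp] c t ct /=; first by exists c.
by case/andP => /(token_step ct)[c' ct'] /(IHp _ _ ct').
Qed.

Lemma plain_adj_sym : symmetric (plain_adj adj).
Proof. by move=> u v; rewrite /plain_adj adjC [plain u && _]andbC. Qed.

Lemma plain_connectE u v : connect (plain_adj adj) u v -> u != v -> plain u /\ plain v.
Proof.
move=> uv; have step x y : connect (plain_adj adj) x y -> x != y -> plain x.
  case/connectP => -[|z p] /=; first by move=> _ ->; rewrite eqxx.
  by case/andP => /and3P[].
by move=> neq; split; [apply: step uv _ | apply: (step v u); rewrite 1?eq_sym //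
  (sym_connect_sym plain_adj_sym)].
Qed.

Definition exempt_coloring c := proper adj c /\
  forall v, big v -> v != w -> c v = None -> defect c v <= 117.

(** Descent on the defect at [w] over colourings without a bound at [w]: by criticality this defect
    always exceeds 117, so with few components two neighbours of [w] in the third part share one,
    and the defect can be lowered. *)
Lemma critical_plain_components :
  117 < #|[set fingraph.root (plain_adj adj) u | u in nbrs adj w]|.
Proof.
rewrite ltnNge; apply/negP => few.
have csym := sym_connect_sym plain_adj_sym.
have bad c : exempt_coloring c -> c w = None /\ 117 < defect c w.
  case=> c_prop c_def; have [//|/negP bad] := boolP ((c w == None) && (117 < defect c w)).
    by case/andP => /eqP.
  case: adjNcol; apply: (weak_colorable adjC adj_irr c_prop) => v bv cv.
  have [vw|] := eqVneq v w; last by move/c_def; apply.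
  by rewrite leqNgt; apply/negP => dv; case: bad; rewrite -vw cv eqxx.
have none c : ~ exempt_coloring c.
  have [k] := ubnP (defect c w); elim: k c => // k IHk c; rewrite ltnS => le_k ec.
  have [cw dw] := bad c ec; case: (ec) => c_prop c_def.
  pose X := [set u | adj w u & c u == None].
  have [x [y [Xx Xy xy rxy]]] : exists x y, [/\ x \in X, y \in X, x != y &
      connect (plain_adj adj) x y].
    have [/existsP[x /existsP[y /and4P[Xx Xy xy rxy]]]|none] := boolP
        [exists x, [exists y, [&& x \in X, y \in X, x != y & connect (plain_adj adj) x y]]].
      by exists x, y.
    suff : #|X| <= 117 by rewrite leqNgt dw.
    rewrite -(@card_in_imset _ _ (fingraph.root (plain_adj adj))); last first.
      move=> x y Xx Xy /eqP; rewrite root_connect // => cxy.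
      apply: contraNeq none => xy; apply/existsP; exists x; apply/existsP; exists y.
      by rewrite Xx Xy xy.
    apply: leq_trans few; apply/subset_leq_card/imsetS/subsetP => u.
    by rewrite !inE => /andP[].
  have [px py] := plain_connectE rxy xy.
  move: (Xx) (Xy); rewrite !inE => /andP[wx /eqP cx] /andP[wy /eqP cy].
  (* Omitting [x] from the allowed set ensures that [x], once recoloured, is no longer in the third
     part. *)
  have tok : token_coloring (X :\ x) c x.
    split=> // [u v uv _ _|v bv vw vx cv|u wu cu ux].
    - exact: c_prop.
    - apply: leq_trans (c_def v bv vw cv); apply/subset_leq_card/subsetP => u.
      by rewrite !inE => /and3P[-> ->].
    by rewrite !inE ux wu cu eqxx.
  have [p pp yE] := connectP rxy.
  have [c' [c'_prop c'_def c'w c'B]] := token_path tok pp.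
  rewrite -yE in c'_prop c'_def c'B.
  have wNy : w != y by apply: contraTneq w_big => ->; apply: plain_small.
  (* The last uncoloured vertex [y] returns to the third part, to which it belonged before, and [w]
     is its only big neighbour; the net effect at [w] is the loss of [x]. *)
  apply: (IHk (recolor c' y None)).
    apply: leq_trans le_k; apply/proper_card/properP; split; last first.
      exists x; rewrite !inE ?wx ?cx //= /recolor (negPf xy).
      by apply/negP => /eqP /(c'B x wx) /(_ xy); rewrite !inE eqxx.
    apply/subsetP => u; rewrite !inE /recolor => /andP[wu].
    case: (eqVneq u y) => [-> _|uy /eqP c'u]; first by rewrite wy cy.
    by have := c'B u wu c'u uy; rewrite !inE => /andP[].
  split=> [u v uv|v bv vw].
    rewrite /recolor; case: (eqVneq u y) => // uy; case: (eqVneq v y) => // vy.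
    exact: c'_prop.
  rewrite {1}/recolor; case: (eqVneq v y) => [E|vy cv].
    by move: bv; rewrite E (negPf (plain_small py)).
  apply: leq_trans (c'_def v bv vw vy cv); apply/subset_leq_card/subsetP => u.
  rewrite !inE /recolor => /andP[vu]; rewrite vu; case: (eqVneq u y) => [E|_ ->//].
  rewrite E adjC in vu; rewrite adjC in wy.
  by rewrite (plain_big_uniq py vu wy bv w_big) eqxx in vw.
(* To start the descent, a plain neighbour [r] of [w] is deleted and put back into the third part.
   If there is none, the neighbours of [w] lie in distinct components and are too many. *)
have [/existsP[r /andP[wr pr]]|Nplain] := boolP [exists r, adj w r && plain r]; last first.
  suff : deg w <= 117 by move: w_big; rewrite /big; lia.
  rewrite /deg -(@card_in_imset _ _ (fingraph.root (plain_adj adj))) // => x y; rewrite !inE => wx wy /eqP.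
  rewrite root_connect // => cxy; apply: contraNeq Nplain => xy.
  by apply/existsP; exists x; rewrite wx; have [] := plain_connectE cxy xy.
have [_ _ _ del] := adj_critical.
have [|c [c_prop c_def]] := del r w; first by rewrite adjC.
apply: (none (recolor c r None)); split=> [u v uv|v bv vw].
  rewrite /recolor; case: (eqVneq u r) => // ur; case: (eqVneq v r) => // vr.
  by apply: c_prop; apply/and3P.
rewrite {1}/recolor; case: (eqVneq v r) => [E|vr cv].
  by move: bv; rewrite E (negPf (plain_small pr)).
apply: leq_trans (c_def v cv); apply/subset_leq_card/subsetP => u.
rewrite !inE /recolor => /andP[vu].
case: (eqVneq u r) => [E|ur ->]; last by rewrite andbT; apply/and3P.
rewrite E adjC in vu; rewrite adjC in wr.
by rewrite (plain_big_uniq pr vu wr bv w_big) eqxx in vw.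
Qed.

End Critical.
End Colorings.

(** * Explicit orbits and changes of label along an orbit *)

Section PorbitTraject.
Variables (D : finType) (s : {perm D}).

Lemma porbit_cycle k x : iter k s x = x -> 0 < k -> porbit s x =i traject s x k.
Proof.
move=> sk k_gt0 y; apply/porbitP/trajectP => [[i ->]|[i _ ->]]; last first.
  by exists i; rewrite permX.
exists (i %% k); first by rewrite ltn_mod.
rewrite permX {1}(divn_eq i k) addnC iterD; congr iter.
by rewrite iterM iter_fix.
Qed.

Lemma sum_porbit_cycle (M : nmodType) (g : D -> M) k x :
  iter k s x = x -> 0 < k -> uniq (traject s x k) ->
  (\sum_(y in porbit s x) g y = \sum_(y <- traject s x k) g y)%R.
Proof.
move=> sk k_gt0 ut; rewrite big_uniq //=; apply: eq_bigl => y.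
exact: porbit_cycle.
Qed.

Lemma sum_porbit_shift (M : nmodType) (g : D -> M) x :
  (\sum_(y in porbit s x) g (s y) = \sum_(y in porbit s x) g y)%R.
Proof.
rewrite [RHS](reindex_inj (@perm_inj _ s)); apply: eq_bigl => y.
by rewrite -!eq_porbit_mem (porbit_perm s 1).
Qed.

(* Entering the set where L takes a given value happens at least once per turn. *)
Lemma card_porbit_changes (T : finType) (L : D -> T) x : 1 < #|L @: porbit s x| ->
  #|L @: porbit s x| <= #|[set y in porbit s x | L (s^-1 y)%g != L y]|.
Proof.
move=> many; apply: leq_trans (leq_imset_card L _).
apply/subset_leq_card/subsetP => _ /imsetP[y xy ->].
have [/existsP[z /and3P[xz /eqP <- ch]]|none] :=
    boolP [exists z, [&& z \in porbit s x, L z == L y & L (s^-1 z)%g != L z]].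
  by apply/imsetP; exists z; rewrite // inE xz.
have const i : L ((s^-1 ^+ i)%g y) = L y.
  elim: i => [|i IHi]; rewrite ?perm1 // expgSr permM.
  apply: contraNeq none => ch; apply/existsP; exists ((s^-1 ^+ i)%g y).
  rewrite IHi eqxx ch !andbT -eq_porbit_mem -[porbit _ (_ y)]porbitV porbit_perm porbitV.
  by rewrite eq_porbit_mem.
suff : #|L @: porbit s x| <= 1 by rewrite leqNgt many.
rewrite -(cards1 (L y)); apply/subset_leq_card/subsetP => _ /imsetP[z xz ->].
have : z \in porbit s^-1 y.
  by rewrite porbitV; move: xy xz; rewrite -!eq_porbit_mem => /eqP -> /eqP ->.
by case/porbitP => i ->; rewrite const inE.
Qed.

End PorbitTraject.

(** * Discharging on the rotation system of a critical graph *)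

Section Discharging.
Variables (V : finType) (adj : rel V).
Hypothesis adj_critical : critical adj.
Hypothesis no_C4 : forall a b c d, adj a b -> adj b c -> adj c d -> adj d a ->
  a != c -> b != d -> False.
Variables (D : finType) (src : D -> V) (e n : {perm D}).
Hypothesis rot : rotation_system adj src e n.

Let adjC : symmetric adj. Proof. by case: adj_critical. Qed.
Let adj_irr : irreflexive adj. Proof. by case: adj_critical. Qed.
Let ee : involutive e. Proof. exact: rs_inv rot. Qed.

Local Notation tgt x := (src (e x)).
Local Notation pre x := (src (e (n^-1%g x))).
Local Notation F := (e * n)%g.
Local Notation big := (big adj).
Local Notation plain := (plain adj).

Lemma FE x : F x = n (e x). Proof. exact: permM. Qed.

Lemma src_n x : src (n x) = src x. Proof. exact: rs_src rot x. Qed.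

Lemma src_nV x : src (n^-1%g x) = src x. Proof. by rewrite -{2}(permKV n x) src_n. Qed.

Lemma src_F x : src (F x) = tgt x. Proof. by rewrite FE src_n. Qed.

Lemma pre_F x : pre (F x) = src x. Proof. by rewrite FE permK ee. Qed.

Lemma pre_n x : pre (n x) = tgt x. Proof. by rewrite permK. Qed.

Lemma adj_tgt x : adj (src x) (tgt x). Proof. exact: rs_adj rot x. Qed.

Lemma adj_F x : adj (src x) (src (F x)). Proof. by rewrite src_F adj_tgt. Qed.

Lemma mem_porbit_src x y : (y \in porbit n x) = (src y == src x).
Proof.
apply/idP/eqP => [|yx]; last exact: (rs_orb rot).
case/porbitP => i ->; elim: i => [|i IHi]; first by rewrite perm1.
by rewrite expgSr permM src_n.
Qed.

Lemma tgt_porbit x : [set tgt y | y in porbit n x] = nbrs adj (src x).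
Proof.
apply/setP => v; rewrite inE; apply/imsetP/idP => [[y xy ->]|xv].
  by move: xy; rewrite mem_porbit_src => /eqP <-; apply: adj_tgt.
have [y yx yv] := rs_surj rot xv; exists y => //.
by rewrite mem_porbit_src yx.
Qed.

Lemma card_porbit_n x : #|porbit n x| = deg adj (src x).
Proof.
rewrite /deg -tgt_porbit card_in_imset // => y z.
rewrite !mem_porbit_src => /eqP yx /eqP zx; apply: (rs_inj rot).
by rewrite yx zx.
Qed.

Lemma deg_src_ge3 x : 3 <= deg adj (src x).
Proof. exact: critical_deg_ge3 adj_critical _ _ (adj_tgt x). Qed.

Lemma n2_neq x : n (n x) != x.
Proof.
apply/eqP => nx; have := deg_src_ge3 x; rewrite -card_porbit_n.
have -> : #|porbit n x| = #|[in traject n x 2]|.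
  by apply: eq_card => y; rewrite (porbit_cycle (k := 2)).
by rewrite leqNgt ltnS (leq_trans (card_size _)).
Qed.

Lemma n_neq x : n x != x.
Proof. by apply/eqP => nx; have := n2_neq x; rewrite !nx eqxx. Qed.

Lemma src_F_neq x : src (F x) != src x.
Proof. by apply/eqP => E; have := adj_F x; rewrite E adj_irr. Qed.

(** A face walk that turns back would make [n] fix the dart [e x], against minimum degree 3. *)
Lemma src_F2_neq x : src (F (F x)) != src x.
Proof.
apply/eqP => E; have := n_neq (e x).
rewrite -FE (_ : F x = e x) ?eqxx //.
by apply: (rs_inj rot); rewrite ?src_F // ee -src_F.
Qed.

Lemma F4_neq x : F (F (F (F x))) != x.
Proof.
apply/eqP => E; apply: (@no_C4 (src x) (src (F x)) (src (F (F x))) (src (F (F (F x)))));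
  rewrite ?adj_F //.
- by rewrite -{2}E adj_F.
- by rewrite eq_sym src_F2_neq.
by rewrite eq_sym src_F2_neq.
Qed.

Definition tri x := F (F (F x)) == x.
Definition pent x := F (F (F (F (F x)))) == x.

Lemma tri_F x : tri (F x) = tri x.
Proof. by rewrite /tri (inj_eq perm_inj). Qed.

Lemma pent_F x : pent (F x) = pent x.
Proof. by rewrite /pent (inj_eq perm_inj). Qed.

Lemma tri_n x : tri (n x) = tri (e x).
Proof. by rewrite -[in n x](ee x) -FE tri_F. Qed.

Lemma tri_pre_adj x : tri x -> adj (pre x) (tgt x).
Proof.
move/eqP => E; rewrite -{1}E pre_F -src_F adjC; exact: adj_F.
Qed.

(** These are the two faces at the edge of [x]. Two triangles there form a 4-cycle if their third
    vertices differ; if they coincide, the target of [x] has degree 2. *)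
Lemma tri_exclusive x : tri x -> ~~ tri (n x).
Proof.
rewrite tri_n => tx; apply/negP => tex.
have E : src (F (F x)) = src (F (F (e x))).
  apply/eqP; apply: contraT => ne.
  case: (@no_C4 (src x) (src (F (F x))) (tgt x) (src (F (F (e x))))) => //.
  - by move/eqP: tx => {1}<-; rewrite adjC adj_F.
  - by rewrite -src_F adjC adj_F.
  - by move/eqP: tex => {1}<-; rewrite adjC adj_F.
  - by rewrite -[in X in adj _ X](ee x) -src_F adjC adj_F.
  by apply/eqP => E; have := adj_tgt x; rewrite -E adj_irr.
have E2 : F x = e (F (F (e x))).
  apply: (rs_inj rot); first by rewrite src_F -[in LHS](eqP tex) src_F.
  by rewrite ee -src_F.
have := n2_neq (e x); rewrite -FE E2 -FE.
by move/eqP: tex => ->; rewrite eqxx.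
Qed.

Local Open Scope ring_scope.

(* Charge that the source of the dart x sends to the face of x, at the corner
   between the darts n^-1 x and x; the unit is 1/60. *)
Definition to_face x : int :=
  if tri x then
    if big (src x) then 120%Z else if big (pre x) || big (tgt x) then 0%Z else 40%Z
  else if pent x then
    if big (src x) then
      if [&& plain (pre x), plain (tgt x) &
             ~~ (plain (src (F (F x))) && plain (src (F (F (F x)))))] then (-3)%Z else 0%Z
    else if ~~ plain (src x) && ~~ (big (pre x) || big (tgt x)) then 3%Z else 0%Z
  else if big (src x) then (-10)%Z else 0%Z.

(* Charge that the source of x sends to its target, with the same unit. *)
Definition to_vertex x : int :=
  if big (src x) && ~~ big (tgt x) then
    90%Z - (if tri x then 60%Z else 0%Z) - (if tri (e x) then 60%Z else 0%Z)
      - (if plain (tgt x) then 0%Z else 6%Z)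
  else 0%Z.

(** In units of 1/60, the charges [3d/2 - 5] and [l - 5] become 90 per dart around a vertex and 60
    per dart around a face, less 300 per orbit. An orbit is thus nonnegative when its final shares
    add up to at least 300. *)
Definition vertex_share x := 90%Z - to_face x - to_vertex x + to_vertex (e x).

Lemma to_face_ge x : (-10)%Z <= to_face x.
Proof. by rewrite /to_face; do 5! case: ifP => // _. Qed.

Lemma sum_int_ge (T : finType) (A : {set T}) (g : T -> int) (c : int) (k : nat) :
  0 <= c -> (k <= #|A|)%N -> (forall y, y \in A -> c <= g y) ->
  c * k%:Z <= \sum_(y in A) g y.
Proof.
move=> c0 kA gc; apply: le_trans (_ : \sum_(y in A) c <= _); last exact: ler_sum.
by rewrite sumr_const -mulr_natr natz ler_wpM2l // lez_nat.
Qed.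

Lemma face_card_ge5 x : ~~ tri x -> (5 <= #|porbit F x|)%N.
Proof.
have := iter_porbit F x; have := card_porbit_neq0 F x.
case: #|_| => [//|[|[|[|[|k]]]]] _ //= E.
- by have := src_F_neq x; rewrite E eqxx.
- by have := src_F2_neq x; rewrite E eqxx.
- by rewrite /tri E eqxx.
by have := F4_neq x; rewrite E eqxx.
Qed.

Lemma face_card_ge6 x : ~~ tri x -> ~~ pent x -> (6 <= #|porbit F x|)%N.
Proof.
move=> /face_card_ge5; have := iter_porbit F x.
by case: #|_| => [|[|[|[|[|[|k]]]]]] //= E _; rewrite /pent E eqxx.
Qed.

Lemma tri_pent_porbit x y : y \in porbit F x -> tri y = tri x /\ pent y = pent x.
Proof.
case/porbitP => i ->; elim: i => [|i [IH1 IH2]]; first by rewrite perm1.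
by rewrite expgSr permM tri_F pent_F.
Qed.

Lemma neq_F1 x : x != F x.
Proof. by apply: contraNneq (src_F_neq x) => {2}->. Qed.

Lemma neq_F2 x : x != F (F x).
Proof. by apply: contraNneq (src_F2_neq x) => {2}->. Qed.

(** The missing 120 comes from any one big vertex, or as 40 from each of three small ones. *)
Lemma tri_face_charge x : tri x -> 300%Z <= \sum_(y in porbit F x) (60%Z + to_face y).
Proof.
move=> tx; have E := eqP tx.
rewrite (@sum_porbit_cycle _ _ _ _ 3) //=; last first.
  by rewrite !inE negb_or neq_F1 neq_F2 neq_F1.
have preE : pre x = src (F (F x)) by rewrite -{1}E pre_F.
rewrite !big_cons big_nil /to_face !tri_F tx !pre_F preE -!src_F E.
by case: (big (src x)); case: (big (src (F x))); case: (big (src (F (F x)))).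
Qed.

(** The face gives 3 to the big vertex [src x] between two plain ones. A plain vertex has one big
    neighbour, so the other two vertices are small; one of them is not plain and repays 3. *)
Lemma pent_face_charge x : ~~ tri x -> pent x -> to_face x < 0 ->
  300%Z <= \sum_(y in porbit F x) (60%Z + to_face y).
Proof.
move=> tx px neg; have E := eqP px.
rewrite (@sum_porbit_cycle _ _ _ _ 5) //=; last first.
  rewrite !inE !(inj_eq perm_inj) !negb_or !neq_F1 !neq_F2 /=.
  by rewrite ![x == _]eq_sym F4_neq -/(tri x) tx.
have preE : pre x = src (F (F (F (F x)))) by rewrite -{1}E pre_F.
rewrite !big_cons big_nil /to_face !tri_F !pent_F (negPf tx) px !pre_F preE -!src_F E.
move: neg; rewrite /to_face (negPf tx) px preE -src_F.
case bx: (big (src x)); last by case: ifP.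
case: ifP => // /and3P[p4 p1 np] _.
have b1 : big (src (F x)) = false by apply/negbTE/(plain_small p1).
have b4 : big (src (F (F (F (F x))))) = false by apply/negbTE/(plain_small p4).
have b2 : big (src (F (F x))) = false.
  apply/negP => b2; have := src_F2_neq x.
  by rewrite (plain_big_uniq p1 (adj_F _) _ b2 bx) ?eqxx // adjC adj_F.
have b3 : big (src (F (F (F x)))) = false.
  apply/negP => b3; have := src_F2_neq (F (F (F x))); rewrite E.
  rewrite (plain_big_uniq p4 _ _ bx b3) ?eqxx //; first by rewrite -{2}E adj_F.
  by rewrite adjC adj_F.
rewrite b1 b2 b3 b4 p1 p4 /=.
by move: np; case: (plain (src (F (F x)))); case: (plain _).
Qed.

Lemma face_charge x : 300%Z <= \sum_(y in porbit F x) (60%Z + to_face y).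
Proof.
have [tx|tx] := boolP (tri x); first exact: tri_face_charge.
have [px|px] := boolP (pent x); last first.
  (* With at least six darts the face can afford to give 10 at each. *)
  apply: le_trans (_ : 50%Z * 6%N%:Z <= _) => //.
  apply: sum_int_ge => // [|y _]; first exact: face_card_ge6.
  by have := to_face_ge y; lia.
have [/existsP[y /andP[xy neg]]|none] := boolP [exists y in porbit F x, to_face y < 0].
  have [ty py] := tri_pent_porbit xy.
  have <- : porbit F y = porbit F x by apply/eqP; rewrite eq_porbit_mem.
  by apply: pent_face_charge; rewrite ?ty ?py.
apply: le_trans (_ : 60%Z * 5%N%:Z <= _) => //.
apply: sum_int_ge => // [|y xy]; first exact: face_card_ge5.
rewrite lerDl leNgt; apply: contraNN none => neg.
by apply/existsP; exists y; rewrite xy.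
Qed.

(** A potential [a] moves charge between consecutive darts of a rotation without altering the total,
    so vertex bounds reduce to bounds at single darts. *)
Lemma sum_porbit_balance (f a : D -> int) x :
  \sum_(y in porbit n x) (f y + a y - a (n y)) = \sum_(y in porbit n x) f y.
Proof. by rewrite sumrB big_split /= sum_porbit_shift addrK. Qed.

Lemma plain_root u v : adj u v -> plain u -> plain v ->
  fingraph.root (plain_adj adj) u = fingraph.root (plain_adj adj) v.
Proof.
move=> uv pu pv; apply/eqP.
rewrite root_connect; last exact/sym_connect_sym/plain_adj_sym/adj_critical.
by apply: connect1; rewrite /plain_adj uv pu pv.
Qed.

Local Notation component y := (fingraph.root (plain_adj adj) (tgt y)).

(** For a small target, the right-hand side is 120 if [tri y], minus [to_face y], plus 3 for each
    non-plain vertex among [pre y] and [tgt y]. It can only vanish when both are plain and the face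
    is a triangle, or a pentagon with its other two small vertices plain. *)
Lemma big_share_ge y : big (src y) ->
  let a z := (if tri z then 60%Z else 0%Z) + (if plain (pre z) then 0%Z else 3%Z) : int in
  (if component (n^-1%g y) != component y then 3%Z else 0%Z)
    <= vertex_share y + a y - a (n y).
Proof.
move=> yB /=; rewrite pre_n /vertex_share /to_vertex ee yB /= andbF -tri_n.
have bt : big (tgt y) ==> ~~ plain (tgt y).
  by apply/implyP => bt; apply/negP => /plain_small; rewrite bt.
have ex : tri y ==> ~~ tri (n y) by apply/implyP/tri_exclusive.
set r := component (n^-1%g y) == component y.
(* In these cases the face contains a plain path between consecutive neighbours, so the component
   does not change. *)
have Rtri : [&& tri y, plain (pre y) & plain (tgt y)] ==> r.
  by apply/implyP => /and3P[ty p1 p2]; apply/eqP/plain_root => //; apply: tri_pre_adj.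
have Rpent : [&& pent y, plain (pre y), plain (tgt y), plain (src (F (F y))) &
    plain (src (F (F (F y))))] ==> r.
  apply/implyP => /and5P[/eqP py p0 p1 p2 p3]; rewrite -src_F in p1.
  have preE : pre y = src (F (F (F (F y)))) by rewrite -{1}py pre_F.
  rewrite preE in p0; apply/eqP; rewrite preE -(src_F y) (plain_root (adj_F (F y)) p1 p2).
  by rewrite (plain_root (adj_F _) p2 p3) (plain_root (adj_F _) p3 p0).
rewrite /to_face yB; move: bt ex Rtri Rpent.
case: (tri y); case: (pent y); case: (tri (n y)); case: (plain (tgt y)) => //;
  case: (big (tgt y)) => //; case: (plain (pre y)); case: (plain _); case: (plain _);
  by case: r.
Qed.

Lemma big_vertex_charge x : big (src x) -> 300%Z <= \sum_(y in porbit n x) vertex_share y.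
Proof.
move=> bx; rewrite -(sum_porbit_balance _
  (fun z => (if tri z then 60%Z else 0%Z) + (if plain (pre z) then 0%Z else 3%Z))).
pose ch y := component (n^-1%g y) != component y.
apply: le_trans (_ : \sum_(y in porbit n x) (if ch y then 3%Z else 0%Z) <= _); last first.
  apply: ler_sum => y; rewrite mem_porbit_src => /eqP yx.
  by apply: big_share_ge; rewrite yx.
rewrite -big_mkcondr /=.
have -> : \sum_(y in porbit n x | ch y) 3%Z = \sum_(y in [set y in porbit n x | ch y]) 3%Z :> int.
  by apply: eq_bigl => y; rewrite inE.
(* At least 118 components give as many changes, worth 354 in total. *)
apply: le_trans (_ : 3%Z * 118%N%:Z <= _) => //; apply: sum_int_ge => //.
have comps : (117 < #|[set component y | y in porbit n x]|)%N.
  have := critical_plain_components adj_critical bx.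
  by rewrite -tgt_porbit -imset_comp.
by apply: leq_trans (card_porbit_changes _); first by []; apply: leq_trans comps.
Qed.

Lemma small_shareE y : ~~ big (src y) -> vertex_share y = 90%Z - to_face y +
  (if big (tgt y) then 90%Z - (if tri (n y) then 60%Z else 0%Z) - (if tri y then 60%Z else 0%Z)
     - (if plain (src y) then 0%Z else 6%Z) else 0%Z).
Proof.
by move=> sy; rewrite /vertex_share /to_vertex ee (negPf sy) andbT subr0 tri_n.
Qed.

(** The potential moves 20 of the cost of a triangle to the preceding corner, which is no triangle.
    The worst cases are 90 - 20 - 3 = 67 for a small target and 90 + 90 - 60 - 6 = 67 + 47 for a big
    one. *)
Lemma small_share_ge y : ~~ big (src y) -> 
  let a z := (if tri z && ~~ big (pre z) then 20%Z else 0%Z) : int in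
  67%Z + (if big (tgt y) then 47%Z else 0%Z) <= vertex_share y + a y - a (n y).
Proof.
move=> sy /=; rewrite small_shareE // pre_n /to_face (negPf sy).
have := @tri_exclusive y.
case: (tri y) => [/(_ isT)/negPf ->|_]; case: (big (tgt y)); case: (big (pre y)) => //=;
  rewrite ?andbF //; case: (plain (src y)) => //; case: (tri (n y)) => //; case: (pent y) => //.
Qed.

Lemma small_vertex_charge_ge4 x : ~~ big (src x) -> (4 <= deg adj (src x))%N -> big (tgt x) ->
  300%Z <= \sum_(y in porbit n x) vertex_share y.
Proof.
move=> sx dx bx; rewrite -(sum_porbit_balance _
  (fun z => if tri z && ~~ big (pre z) then 20%Z else 0%Z)).
apply: le_trans (_ : \sum_(y in porbit n x) (67%Z + (if big (tgt y) then 47%Z else 0%Z)) <= _);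
  last first.
  apply: ler_sum => y; rewrite mem_porbit_src => /eqP yx.
  by apply: small_share_ge; rewrite yx.
(* Four darts, one of them towards a big vertex, give 315. *)
rewrite big_split /=; apply: le_trans (_ : 67%Z * 4%N%:Z + 47%Z <= _) => //.
apply: lerD; first by apply: sum_int_ge; rewrite ?card_porbit_n.
rewrite (bigD1 x) ?porbit_id //= bx lerDl; apply: sumr_ge0 => y _.
by case: ifP.
Qed.

(** Any two of the three corners share an edge, so at most one is a triangle, and a non-plain vertex
    has a second big neighbour. The bound is attained by a plain vertex with a triangle at its big
    neighbour: 270 + 90 - 60. *)
Lemma small_vertex_charge3 x : ~~ big (src x) -> deg adj (src x) = 3%N -> big (tgt x) ->
  300%Z <= \sum_(y in porbit n x) vertex_share y.
Proof.
move=> sx dx bx.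
have n3 : n (n (n x)) = x by have := iter_porbit n x; rewrite card_porbit_n dx.
have npl : ~~ plain (src x) -> big (tgt (n x)) || big (tgt (n (n x))).
  apply: contraNT; rewrite negb_or => /andP[/negPf b1 /negPf b2].
  rewrite /plain dx eqxx /=; apply/cards1P; exists (tgt x); apply/setP => u.
  rewrite !inE; apply/andP/eqP => [[xu]|->]; last by rewrite adj_tgt bx.
  have : u \in nbrs adj (src x) by rewrite inE.
  rewrite -tgt_porbit => /imsetP[y + ->].
  rewrite (porbit_cycle (k := 3)) //= !inE => /or3P[] /eqP -> //; rewrite ?b1 ?b2 //.
rewrite (@sum_porbit_cycle _ _ _ _ 3) //=; last first.
  by rewrite !inE !(inj_eq perm_inj) !negb_or ![x == _]eq_sym !n_neq n2_neq.
rewrite !big_cons big_nil !small_shareE ?src_n // n3 bx.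
have ex0 : tri x ==> ~~ tri (n x) by apply/implyP/tri_exclusive.
have ex1 : tri (n x) ==> ~~ tri (n (n x)) by apply/implyP/tri_exclusive.
have ex2 : tri (n (n x)) ==> ~~ tri x by apply/implyP => /tri_exclusive; rewrite n3.
rewrite /to_face !src_n (negPf sx) !pre_n bx ?orbT /=.
move: npl => /implyP; move: ex0 ex1 ex2.
case: (tri x); case: (tri (n x)) => //; case: (tri (n (n x))) => //;
  case: (plain (src x)); case: (big (tgt (n x))); case: (big (tgt (n (n x)))) => //;
  case: (pent x); case: (pent (n x)); case: (pent (n (n x))); by [].
Qed.

Lemma vertex_charge x : 300%Z <= \sum_(y in porbit n x) vertex_share y.
Proof.
have [bx|sx] := boolP (big (src x)); first exact: big_vertex_charge.
have [b xb bb] := critical_has_big adj_critical (adj_tgt x) sx.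
have [y yx yb] := rs_surj rot xb.
have <- : porbit n y = porbit n x by apply/eqP; rewrite eq_porbit_mem mem_porbit_src yx.
rewrite -yx in sx; rewrite -yb in bb.
have := deg_src_ge3 y; rewrite leq_eqVlt => /orP[/eqP d3|d4].
  exact: small_vertex_charge3.
exact: small_vertex_charge_ge4.
Qed.

Lemma critical_no_darts : #|D| = 0%N.
Proof.
apply/eqP; rewrite -leqn0 leqNgt; apply/negP => D_gt0.
have euler := rs_euler rot D_gt0.
have Hn : 300%Z * #|porbits n|%:Z <= \sum_x vertex_share x.
  rewrite (sum_porbits n); apply: sum_int_ge => // _ /imsetP[x _ ->].
  exact: vertex_charge.
have HF : 300%Z * #|porbits F|%:Z <= \sum_x (60%Z + to_face x).
  rewrite (sum_porbits F); apply: sum_int_ge => // _ /imsetP[x _ ->].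
  exact: face_charge.
have E : \sum_x vertex_share x + \sum_x (60%Z + to_face x) = 150%Z * #|D|%:Z.
  rewrite -big_split /= (eq_bigr (fun x => 150%Z + to_vertex (e x) - to_vertex x)); last first.
    by move=> x _; rewrite /vertex_share; lia.
  rewrite sumrB big_split /= [X in _ - X](reindex_inj (@perm_inj _ e)) addrK.
  by rewrite sumr_const -mulr_natr natz.
(* The orbits need 300 each, in total at least [150 * #|D| + 600] by Euler's formula, but only
   [150 * #|D|] is available. *)
move: euler Hn HF E; move: (\sum_x _) (\sum_x _) => s1 s2.
by move: #|porbits n| #|porbits F| #|D|; lia.
Qed.

End Discharging.

(** * Disjoint connected fibers built from overlapping sets of cells *)

Section Cells.
Variables (T V : finType) (cadj : rel T).
Hypothesis cadjC : symmetric cadj.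

Definition cut_connected (X : {set T}) := forall (S : {set T}) a b,
  a \in X -> b \in X -> a \in S -> b \notin S ->
  exists c d, [/\ cadj c d, c \in S, d \notin S, c \in X & d \in X].

Definition within (X : {set T}) c d := [&& cadj c d, c \in X & d \in X].

Lemma within_sym X : symmetric (within X).
Proof. by move=> c d; rewrite /within cadjC [(c \in X) && _]andbC. Qed.

Lemma connect_cut (r : rel T) (S : {set T}) a b : connect r a b -> a \in S -> b \notin S ->
  exists c d, [/\ r c d, c \in S & d \notin S].
Proof.
case/connectP => p + ->; elim: p a => [|x p IHp] a /=; first by move=> _ ->.
case/andP => ax xp aS lS; have [xS|xS] := boolP (x \in S); first exact: IHp xp xS lS.
by exists a, x.
Qed.

Lemma cut_connectedP X :
  cut_connected X <-> forall a b, a \in X -> b \in X -> connect (within X) a b.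
Proof.
split=> [conn a b aX bX|conn S a b aX bX aS bS]; last first.
  have [c [d [/and3P[cd cX dX] cS dS]]] := connect_cut (conn a b aX bX) aS bS.
  by exists c, d.
apply: contraT => ab.
have [|| c [d [cd]]] := conn [set c | connect (within X) a c] a b aX bX.
- by rewrite inE connect0.
- by rewrite inE.
rewrite !inE => ac nad cX dX; case/negP: nad.
by apply: connect_trans ac (connect1 _); apply/and3P.
Qed.

Variables (E : rel V) (K : V -> {set T}) (M : V -> V -> {set T}).
Hypothesis K_conn : forall u, cut_connected (K u).
Hypothesis M_conn : forall u v, E u v -> cut_connected (M u v).
Hypothesis KK : forall u v c, c \in K u -> c \in K v -> u = v.
Hypothesis MK : forall u v w c, E u v -> c \in M u v -> c \in K w -> w = u \/ w = v.
Hypothesis MM : forall u v u' v' c, E u v -> E u' v' -> c \in M u v -> c \in M u' v' ->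
  u = u' /\ v = v'.
Hypothesis ME : forall u v, E u v ->
  (exists2 c, c \in K u & c \in M u v) /\ (exists2 c, c \in K v & c \in M u v).
Hypothesis E_irr : irreflexive E.

(** [M u v] may overlap both [K u] and [K v]. The vertex [u] receives those cells of it that can be
    reached from [K u] before entering [K v]. *)
Let stem u v := M u v :\: K v.
Let reach u v := [set c | [exists r, [&& r \in K u, r \in M u v & connect (within (stem u v)) r c]]].
Let fiber u := K u :|: \bigcup_(v | E u v) reach u v.

Let E_neq u v : E u v -> u != v.
Proof. by apply: contraTneq => ->; rewrite E_irr. Qed.

Let reach_stem u v c : E u v -> c \in reach u v -> c \in stem u v.
Proof.
move=> uv; rewrite inE => /existsP[r /and3P[rK rM rc]]; apply: contraT => cs.
have rs : r \in stem u v.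
  by rewrite inE rM andbT; apply: contra (E_neq uv) => /(KK rK) ->.
by have [x [y [/and3P[_ _ ys] _]]] := connect_cut rc rs cs; rewrite ys.
Qed.

Let K_fiber u : K u \subset fiber u. Proof. exact: subsetUl. Qed.

Let reach_fiber u v : E u v -> reach u v \subset fiber u.
Proof.
by move=> uv; apply: subset_trans (subsetUr _ _); apply: (bigcup_sup v).
Qed.

Let fiber_uniq u w c : c \in fiber u -> c \in fiber w -> u = w.
Proof.
have mixed x y v : c \in K x -> E y v -> c \in reach y v -> x = y.
  move=> cK yv /(reach_stem yv); rewrite !inE => /andP[cv cM].
  by case: (MK yv cM cK) => // xv; rewrite -xv cK in cv.
move=> /setUP[cu|/bigcupP[v uv cu]] /setUP[cw|/bigcupP[x wx cw]].
- exact: KK cu cw.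
- exact: mixed cu wx cw.
- by apply/esym/(mixed _ _ _ cw uv cu).
have /setDP[cu' _] := reach_stem uv cu; have /setDP[cw' _] := reach_stem wx cw.
by have [] := MM uv wx cu' cw'.
Qed.

Let fiber_conn u : cut_connected (fiber u).
Proof.
apply/cut_connectedP.
have Kconn a b : a \in K u -> b \in K u -> connect (within (fiber u)) a b.
  move=> aK bK; have /cut_connectedP/(_ a b aK bK) := @K_conn u.
  apply: connect_sub => x y /and3P[xy xK yK]; apply/connect1/and3P.
  by rewrite xy !(subsetP (K_fiber u)).
have root a : a \in fiber u -> exists2 k, k \in K u & connect (within (fiber u)) k a.
  case/setUP => [aK|/bigcupP[v uv]]; first by exists a; rewrite ?connect0.
  rewrite inE => /existsP[k /and3P[kK kM ka]]; exists k => //.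
  case/connectP: ka => p; elim/last_ind: p a => [|p x IHp] a.
    by move=> _ ->; apply: connect0.
  rewrite rcons_path last_rcons => /andP[kp px] ->.
  apply: connect_trans (IHp _ kp erefl) (connect1 _).
  have inreach q : path (within (stem u v)) k q -> last k q \in fiber u.
    move=> kq; apply: (subsetP (reach_fiber uv)); rewrite inE; apply/existsP; exists k.
    by rewrite kK kM; apply/connectP; exists q.
  apply/and3P; split; [by case/and3P: px | exact: inreach |].
  by have := inreach (rcons p x); rewrite last_rcons rcons_path kp px; apply.
move=> a b /root[k kK ka] /root[l lK lb].
rewrite (connect_trans _ (connect_trans (Kconn k l kK lK) lb)) //.
by rewrite (sym_connect_sym (@within_sym _)).
Qed.

(** Connectedness of [M u v] gives a step leaving [reach u v]; its end lies in [K v], since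
    otherwise it could be reached too. *)
Let fiber_link u v : E u v -> exists c d, [/\ cadj c d, c \in fiber u & d \in fiber v].
Proof.
move=> uv; have [[r rK rM] [k kK kM]] := ME uv.
have rR : r \in reach u v.
  by rewrite inE; apply/existsP; exists r; rewrite rK rM connect0.
have kR : k \notin reach u v.
  by apply/negP => /(reach_stem uv); rewrite inE kK.
have [c [d [cd cR dR cM dM]]] := M_conn uv rM kM rR kR.
exists c, d; rewrite cd (subsetP (reach_fiber uv)) //; split=> //.
apply: (subsetP (K_fiber v)); apply: contraNT dR => dK.
move: (cR); rewrite !inE => /existsP[r' /and3P[r'K r'M r'c]].
apply/existsP; exists r'; rewrite r'K r'M; apply: connect_trans r'c (connect1 _).
by apply/and3P; split=> //; [apply: reach_stem | rewrite inE dK].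
Qed.

Lemma minor_of_cells : exists cls : T -> option V,
  (forall (S : {set T}) u a b, cls a = Some u -> cls b = Some u -> a \in S -> b \notin S ->
    exists c d, [/\ cadj c d, c \in S, d \notin S, cls c = Some u & cls d = Some u]) /\
  (forall u v, E u v -> exists c d, [/\ cadj c d, cls c = Some u & cls d = Some v]).
Proof.
pose cls c := [pick u | c \in fiber u].
have clsE c u : (cls c = Some u) <-> c \in fiber u.
  rewrite /cls; split; first by case: pickP => // w cw [<-].
  by case: pickP => [w cw cu|/(_ u) ->//]; rewrite (fiber_uniq cw cu).
exists cls; split=> [S u a b /clsE au /clsE bu aS bS|u v /fiber_link[c [d [cd cu dv]]]].
  have [c [d [cd cS dS cu du]]] := fiber_conn au bu aS bS.
  by exists c, d; split=> //; apply/clsE.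
by exists c, d; split=> //; apply/clsE.
Qed.

End Cells.

From mathcomp Require Import all_classical all_reals all_analysis.
From mathcomp Require Import lra.
Import numFieldNormedType.Exports.

(** * Closed square cells in the plane *)

Section SquareCells.
Local Open Scope classical_set_scope.
Local Open Scope ring_scope.
Variables (R : realType) (h b : R) (m : nat).
Hypothesis h_gt0 : 0 < h.

Let I := 'I_m.+1.

Definition strip (i : I) : set R := `[i%:R * h - b, i.+1%:R * h - b].

Definition square (c : I * I) : set (R * R) :=
  [set p | strip c.1 p.1 /\ strip c.2 p.2].

Lemma closed_square c : closed (square c).
Proof.
have -> : square c = fst @^-1` strip c.1 `&` snd @^-1` strip c.2 by [].
apply: closedI; apply: closed_comp; try exact: itv_closed.
  by move=> p _; exact: cvg_fst.
by move=> p _; exact: cvg_snd.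
Qed.

Lemma strip_cover t : - b <= t <= m.+1%:R * h - b -> exists i, strip i t.
Proof.
suff main k : (k <= m.+1)%N -> - b <= t -> t <= k%:R * h - b -> exists i, strip i t.
  by case/andP; apply: main.
elim: k => [|k IHk] lekm t0 tk.
  exists ord0; rewrite /strip /= in_itv /= mul0r sub0r t0 /=.
  by apply: le_trans tk _; rewrite mul0r lerB // mul1r ltW.
have [tk'|tk'] := leP t (k%:R * h - b); first by apply: IHk => //; apply: ltnW.
exists (Ordinal lekm); rewrite /strip /= in_itv /= tk (ltW tk').
by [].
Qed.

Lemma strip_near i j t : strip i t -> strip j t -> (i <= j.+1)%N.
Proof.
rewrite /strip /= !in_itv /= => /andP[it _] /andP[_ tj].
by rewrite -(ler_nat R) -(ler_pM2r h_gt0); lra.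
Qed.

Lemma strip_dist i s t : strip i s -> strip i t -> `|s - t| <= h.
Proof.
rewrite /strip /= !in_itv /= -natr1 mulrDl mul1r => /andP[s1 s2] /andP[t1 t2].
by rewrite ler_norml; apply/andP; split; lra.
Qed.

Definition meeting (C : set (R * R)) : {set I * I} := [set c | `[< C `&` square c !=set0 >]]%SET.

Lemma meetingP C c : reflect (C `&` square c !=set0) (c \in meeting C).
Proof. by rewrite inE; apply: asboolP. Qed.

(* Cells meeting at a corner are joined through the other cells at this corner. *)
Lemma meeting_connected C : connected C ->
  (forall p, C p -> (- b <= p.1 <= m.+1%:R * h - b) && (- b <= p.2 <= m.+1%:R * h - b)) ->
  cut_connected (@cell_adj m) (meeting C).
Proof.
move=> C_conn C_in S c0 d0 /meetingP[p0 [Cp0 cp0]] /meetingP[q0 [Cq0 dq0]] c0S d0S.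
pose X := \bigcup_(c in [set` S]) square c.
pose Y := \bigcup_(c in [set` ~: S]%SET) square c.
have X_closed : closed X by apply: closed_bigcup => // c _; apply: closed_square.
have Y_closed : closed Y by apply: closed_bigcup => // c _; apply: closed_square.
have CXY p : C p -> X p \/ Y p.
  move=> /C_in/andP[/strip_cover[i pi] /strip_cover[j pj]].
  have [ijS|ijS] := boolP ((i, j) \in S); [left|right]; exists (i, j) => //=.
  by rewrite inE.
(* Two closed sets covering the connected set [C] and both meeting it have a common point in [C]. *)
have [p [Cp [Xp Yp]]] : exists p, C p /\ X p /\ Y p.
  apply: contrapT => none.
  have CX : C `&` X = C.
    apply: C_conn.
    - by exists p0; split=> //; exists c0.
    - exists (~` Y); first exact: closed_openC.
      rewrite predeqE => p; split=> -[Cp Zp]; split=> //.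
        by move=> Yp; apply: none; exists p.
      by case: (CXY p Cp).
    by exists X.
  apply: none; exists q0; split=> //; split.
    by have [] : (C `&` X) q0 by rewrite CX.
  by exists d0 => //=; rewrite inE.
case: Xp => -[i j] /= ijS [/= pi pj]; case: Yp => -[i' j'] /=; rewrite inE => ijS' [/= pi' pj'].
have ii' := strip_near pi pi'; have i'i := strip_near pi' pi.
have jj' := strip_near pj pj'; have j'j := strip_near pj' pj.
have meets k l : strip k p.1 -> strip l p.2 -> (k, l) \in meeting C.
  by move=> pk pl; apply/meetingP; exists p.
have adj1 (k l : I) : (k <= l.+1)%N -> (l <= k.+1)%N -> k != l -> (k.+1 == l) || (l.+1 == k :> nat).
  by rewrite -val_eqE /=; lia.
(* The intermediate cell [(i, j')] also contains [p], and it equals or shares a side with each of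
   the other two. *)
have [S1|S1] := boolP ((i, j') \in S).
  exists (i, j'), (i', j'); rewrite !meets //; split=> //.
  apply/orP; right; rewrite /= eqxx adj1 //.
  by apply: contraNneq ijS' => <-.
exists (i, j), (i, j'); rewrite !meets //; split=> //.
apply/orP; left; rewrite /= eqxx adj1 //.
by apply: contraNneq S1 => <-.
Qed.

End SquareCells.

(** * A common mesh for finitely many compact sets *)

Section CompactFamilies.
Local Open Scope classical_set_scope.
Local Open Scope ring_scope.
Variable R : realType.

(** Each point of [X] has a ball of some radius [r] missing [Y]; half of it serves as neighbourhood
    and the other half bounds [h]. Near-covering compactness makes [h] uniform. *)
Lemma compact_separation (X Y : set (R * R)) : compact X -> compact Y -> X `&` Y = set0 ->
  \forall h \near 0^'+, forall x y, X x -> Y y -> `|x.1 - y.1| <= h -> `|x.2 - y.2| <= h -> False.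
Proof.
move=> cX cY XY0.
have Y_closed : closed Y by apply: compact_closed cY; exact: norm_hausdorff.
have := cX; rewrite compact_near_coveringP => /(_ _ (0^'+)
  (fun h x => forall y, Y y -> `|x.1 - y.1| <= h -> `|x.2 - y.2| <= h -> False)).
move=> /(_ _) cov.
suff : \forall h \near 0^'+, X `<=` (fun x => forall y, Y y ->
    `|x.1 - y.1| <= h -> `|x.2 - y.2| <= h -> False).
  by apply: filterS => h H x y Xx; apply: H.
apply: cov => x Xx.
have : nbhs x (~` Y).
  apply: open_nbhs_nbhs; split; first exact: closed_openC.
  by move=> Yx; have : (X `&` Y) x by []; rewrite XY0.
rewrite -nbhs_ballE => -[r r_gt0 rY].
exists (ball x (r / 2), [set h | h < r / 2]) => /=.
  split; first by apply: nbhsx_ballx; rewrite divr_gt0.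
  by apply: nbhs_right_lt; rewrite divr_gt0.
move=> [x' h] /= [xx' hr] y Yy d1 d2; apply: (rY y) => //.
have [xx1 xx2] := xx'.
move: xx1 xx2; rewrite /ball /= => xx1 xx2.
split; rewrite /ball /=.
  apply: le_lt_trans (ler_distD x'.1 _ _) _; rewrite -/(_ - _); lra.
apply: le_lt_trans (ler_distD x'.2 _ _) _; lra.
Qed.

Lemma cells_of_compacts (J : finType) (P : J -> set (R * R)) : (forall j, compact (P j)) ->
  exists h b m, [/\ 0 < h,
    forall j p, P j p -> (- b <= p.1 <= m.+1%:R * h - b) && (- b <= p.2 <= m.+1%:R * h - b) &
    forall j k c, P j `&` P k = set0 ->
      c \in meeting h b m (P j) -> c \in meeting h b m (P k) -> False].
Proof.
move=> cP.
have [h [h_gt0 hP]] : exists h, 0 < h /\ forall jk : J * J, P jk.1 `&` P jk.2 = set0 ->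
    forall x y, P jk.1 x -> P jk.2 y -> `|x.1 - y.1| <= h -> `|x.2 - y.2| <= h -> False.
  have : \forall h \near 0^'+, forall jk : J * J, P jk.1 `&` P jk.2 = set0 ->
    forall x y, P jk.1 x -> P jk.2 y -> `|x.1 - y.1| <= h -> `|x.2 - y.2| <= h -> False.
    apply: filter_forall => -[j k] /=; have [jk0|] := pselect (P j `&` P k = set0).
      by apply: filterS (compact_separation (cP j) (cP k) jk0) => h H _ x y; apply: H.
    by move=> jk; apply: nearW.
  move=> H; have [h [h_gt0 hP]] : exists h : R, 0 < h /\ (forall jk : J * J, P jk.1 `&` P jk.2 = set0 ->
    forall x y, P jk.1 x -> P jk.2 y -> `|x.1 - y.1| <= h -> `|x.2 - y.2| <= h -> False).
    near (0 : R)^'+ => h; exists h; split; [by near: h; exact: nbhs_right_gt|by near: h].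
  by exists h.
have [B HB] : exists B, forall j p, P j p -> `|p| <= B.
  have : \forall B \near +oo, forall j p, P j p -> `|p| <= B.
    by apply: filter_forall => j; apply: compact_bounded (cP j).
  move=> HB; near (+oo : set_system R) => B; exists B; near: B; exact: HB.
(* Then [m + 1] cells of width [h] starting at [-B] reach beyond [B]. *)
pose m := Num.trunc ((B + B) / h).
have Bm : B + B <= m.+1%:R * h.
  by rewrite -ler_pdivrMr // ltW // truncnS_gt.
exists h, B, m; split=> // [j p /HB|j k c jk0 /meetingP[p [Pp [p1 p2]]] /meetingP[q [Pq [q1 q2]]]].
  rewrite prod_normE ge_max !ler_norml => /andP[/andP[? ?] /andP[? ?]].
  by apply/andP; split; apply/andP; split; lra.
exact: (hP (j, k) jk0 p q) (strip_dist p1 q1) (strip_dist p2 q2).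
Unshelve. all: by end_near.
Qed.

End CompactFamilies.

Lemma cell_adj_sym m : symmetric (@cell_adj m).
Proof.
move=> a b; rewrite /cell_adj [a.1 == _]eq_sym [a.2 == _]eq_sym.
by rewrite [(a.2.+1 == _) || _]orbC [(a.1.+1 == _) || _]orbC.
Qed.

(** * From a plane drawing to a rotation system *)

Section PlanarRotation.
Local Open Scope classical_set_scope.
Local Open Scope ring_scope.
Variables (R : realType) (V : finType) (adj : rel V).
Hypothesis adjC : symmetric adj.
Hypothesis adj_irr : irreflexive adj.
Variables (pos : V -> R * R) (A : V -> V -> set (R * R)) (g : V -> V -> R -> R * R).
Hypothesis drawing : plane_drawing adj pos A.

Definition oriented u v := adj u v && (enum_rank u < enum_rank v)%N.

Hypothesis gP : forall u v, oriented u v -> [/\ {within `[0, 1], continuous (g u v)},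
  {in `[0, 1] &, injective (g u v)}, g u v 0 = pos u, g u v 1 = pos v &
  A u v = g u v @` `[0, 1]].

Let sub_arc u v (a b : R) := g u v @` `[a, b].

(** Whole edges meet at their endpoints, so edges are cut into thirds: outer thirds belong to the
    halos, middle thirds are bridges. A non-neighbour contributes the point [pos u], so the halo of
    an isolated vertex is also nonempty. *)
Let halo_part u v := if oriented u v then sub_arc u v 0 (1 / 3)
  else if oriented v u then sub_arc v u (2 / 3) 1 else [set pos u].

Let halo u := \big[setU/set0]_(v <- enum V) halo_part u v.

Let bridge u v := sub_arc u v (1 / 3) (2 / 3).

Let haloE u : halo u = \bigcup_v halo_part u v.
Proof.
rewrite /halo -bigcup_seq; apply: eq_bigcupl.
by split=> v //= _; rewrite mem_enum.
Qed.

Let arc_within u v a b : oriented u v -> 0 <= a -> b <= 1 -> {within `[a, b], continuous (g u v)}.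
Proof.
move=> /gP[gc _ _ _ _] a0 b1; apply: continuous_subspaceW gc => t /=.
by rewrite !in_itv /= => /andP[? ?]; apply/andP; split; lra.
Qed.

Let arc_compact u v a b : oriented u v -> 0 <= a -> b <= 1 -> compact (sub_arc u v a b).
Proof.
by move=> uv a0 b1; apply: continuous_compact; [apply: arc_within | apply: segment_compact].
Qed.

Let arc_connected u v a b : oriented u v -> 0 <= a -> b <= 1 -> connected (sub_arc u v a b).
Proof.
move=> uv a0 b1; apply: connected_continuous_connected; last exact: arc_within.
exact: segment_connected.
Qed.

Let halo_part_pos u v : halo_part u v (pos u).
Proof.
rewrite /halo_part; case: ifP => [/gP[_ _ g0 _ _]|_].
  by exists 0 => //=; rewrite in_itv /=; apply/andP; split; lra.
case: ifP => [/gP[_ _ _ g1 _]|_] //.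
by exists 1 => //=; rewrite in_itv /=; apply/andP; split; lra.
Qed.

Let halo_compact u : compact (halo u).
Proof.
apply: bigsetU_compact => v _; rewrite /halo_part; case: ifP => uv.
  by apply: arc_compact => //; lra.
by case: ifP => vu; [apply: arc_compact => //; lra | apply: compact_set1].
Qed.

Let halo_connected u : connected (halo u).
Proof.
rewrite haloE; apply: bigcup_connected; first by exists (pos u) => v _; apply: halo_part_pos.
move=> v _; rewrite /halo_part; case: ifP => uv.
  by apply: arc_connected => //; lra.
by case: ifP => vu; [apply: arc_connected => //; lra | apply: connected1].
Qed.

Let near_end (u x y : V) (t : R) := x = u /\ t <= 1 / 3 \/ y = u /\ 2 / 3 <= t.

Let haloP u p : halo u p -> p = pos u \/
  exists x y t, [/\ oriented x y, 0 <= t <= 1, g x y t = p & near_end u x y t].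
Proof.
rewrite haloE => -[v _]; rewrite /halo_part; case: ifP => [uv [t /=]|_].
  rewrite in_itv /= => /andP[t0 t1] <-; right; exists u, v, t; split=> //; last by left.
  by apply/andP; split; lra.
case: ifP => [vu [t /=]|_ ->]; last by left.
rewrite in_itv /= => /andP[t0 t1] <-; right; exists v, u, t; split=> //; last by right.
by apply/andP; split; lra.
Qed.

Let arc_pos x y t w : oriented x y -> 0 <= t <= 1 -> g x y t = pos w ->
  w = x /\ t = 0 \/ w = y /\ t = 1.
Proof.
move=> xy t01 gt; have [gc gi g0 g1 gA] := gP xy.
have /andP[xy' _] := xy.
have in01 s : 0 <= s <= 1 -> s \in `[0, 1] by rewrite in_itv.
have := edge_vertex drawing (w := w) xy'; rewrite gA => H.
have [|wx|wy] := H; first by exists t => //=; apply: in01.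
- left; split=> //; apply: gi; rewrite ?in01 ?lexx ?ler01 //.
  by rewrite gt g0 wx.
- right; split=> //; apply: gi; rewrite ?in01 ?lexx ?ler01 //.
  by rewrite gt g1 wy.
Qed.

Let arc_cross x y x' y' t t' : oriented x y -> oriented x' y' -> 0 <= t <= 1 -> 0 <= t' <= 1 ->
  g x y t = g x' y' t' -> [/\ x = x', y = y' & t = t'] \/ exists w, g x y t = pos w.
Proof.
move=> xy xy' t01 t01' gt; have [gc gi g0 g1 gA] := gP xy; have [_ _ _ _ gA'] := gP xy'.
have /andP[adjxy lxy] := xy; have /andP[adjxy' lxy'] := xy'.
have in01 s : 0 <= s <= 1 -> s \in `[0, 1] by rewrite in_itv.
have [eq_sets|ne] := eqVneq [set x; y]%SET [set x'; y']%SET.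
  left; have : x \in [set x'; y']%SET by rewrite -eq_sets !inE eqxx.
  have : y \in [set x'; y']%SET by rewrite -eq_sets !inE eqxx orbT.
  rewrite !inE => /orP[]/eqP Ey /orP[]/eqP Ex; subst.
  - by rewrite ltnn in lxy.
  - by have := ltn_trans lxy lxy'; rewrite ltnn.
  - by split=> //; apply: gi; rewrite ?in01.
  - by rewrite ltnn in lxy.
right; have [w _ pw] : range pos (g x y t); last by exists w.
apply: (edge_cross drawing adjxy adjxy' ne); rewrite gA gA'; split.
  by exists t => //=; apply: in01.
by exists t' => //=; apply: in01.
Qed.

Let near_end_pos u x y t w : oriented x y -> 0 <= t <= 1 -> near_end u x y t ->
  g x y t = pos w -> w = u.
Proof.
move=> xy t01 nu /(arc_pos xy t01)[] [-> t0]; case: nu => -[E ht] //; exfalso; lra.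
Qed.

Let halo_disjoint u w : u != w -> halo u `&` halo w = set0.
Proof.
move=> uw; rewrite -subset0 => p [/haloP up /haloP wp].
suff E : u = w by rewrite E eqxx in uw.
case: up wp => [-> |[x [y [t [xy t01 gt nu]]]]] [pw|[x' [y' [t' [xy' t01' gt' nw]]]]].
- exact: (pos_inj drawing).
- exact: near_end_pos nw gt'.
- by apply/esym/(near_end_pos xy t01 nu); rewrite gt.
have [[E1 E2 E3]|[z gz]] := arc_cross xy xy' t01 t01' (etrans gt (esym gt')); last first.
  rewrite -(near_end_pos xy t01 nu gz); apply: (near_end_pos xy' t01' nw).
  by rewrite gt' -gt.
by subst; case: nu => -[<- ?]; case: nw => -[<- ?] //; exfalso; lra.
Qed.

Let bridge_pos x y t w : oriented x y -> t \in `[1 / 3, 2 / 3] -> g x y t <> pos w.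
Proof.
rewrite in_itv /= => xy /andP[t1 t2] /(arc_pos xy) H.
have [|[_ ?]|[_ ?]] := H; [by apply/andP; split; lra | lra..].
Qed.

Let bridge_halo x y w : oriented x y -> w != x -> w != y -> bridge x y `&` halo w = set0.
Proof.
move=> xy wx wy; rewrite -subset0 => p [[t t12 gt] /haloP[pw|]].
  by case: (bridge_pos (w := w) xy t12); rewrite gt.
case=> x' [y' [t' [xy' t01' gt' nw]]].
have t01 : 0 <= t <= 1 by move: t12; rewrite /= in_itv /= => /andP[? ?]; apply/andP; split; lra.
have [[E1 E2 E3]|[z gz]] := arc_cross xy xy' t01 t01' (etrans gt (esym gt')); last first.
  exact: bridge_pos xy t12 gz.
by subst; case: nw => -[E _]; [rewrite E eqxx in wx | rewrite E eqxx in wy].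
Qed.

Let bridge_disjoint x y x' y' : oriented x y -> oriented x' y' -> (x, y) != (x', y') ->
  bridge x y `&` bridge x' y' = set0.
Proof.
move=> xy xy' ne; rewrite -subset0 => p [[t t12 gt] [t' t12' gt']].
have in01 (s : R) : s \in `[1 / 3, 2 / 3] -> 0 <= s <= 1.
  by rewrite in_itv /= => /andP[? ?]; apply/andP; split; lra.
have [[E1 E2 E3]|[z gz]] := arc_cross xy xy' (in01 _ t12) (in01 _ t12') (etrans gt (esym gt')).
  by rewrite E1 E2 eqxx in ne.
exact: bridge_pos xy t12 gz.
Qed.

Let bridge_ends x y : oriented x y ->
  (halo x `&` bridge x y) !=set0 /\ (halo y `&` bridge x y) !=set0.
Proof.
move=> xy; have Nyx : oriented y x = false.
  by apply/negP => /andP[_ lyx]; have /andP[_ /(ltn_trans lyx)] := xy; rewrite ltnn.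
split.
  exists (g x y (1 / 3)); split; last by exists (1 / 3) => //=; rewrite in_itv /=; apply/andP; split; lra.
  rewrite haloE; exists y => //; rewrite /halo_part xy.
  by exists (1 / 3) => //=; rewrite in_itv /=; apply/andP; split; lra.
exists (g x y (2 / 3)); split; last by exists (2 / 3) => //=; rewrite in_itv /=; apply/andP; split; lra.
rewrite haloE; exists x => //; rewrite /halo_part Nyx xy.
by exists (2 / 3) => //=; rewrite in_itv /=; apply/andP; split; lra.
Qed.

Lemma drawing_rotation :
  exists (D : finType) (src : D -> V) (e n : {perm D}), rotation_system adj src e n.
Proof.
(* Pairs that are not oriented edges get the empty set, so all halos and bridges form one finite
   family of compact sets. *)
pose P (j : V + V * V) := match j with
  | inl u => halo u | inr uv => if oriented uv.1 uv.2 then bridge uv.1 uv.2 else set0 end.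
have cP j : compact (P j).
  case: j => [u|[u v]] /=; first exact: halo_compact.
  by case: ifP => uv; [apply: arc_compact => //; lra | apply: compact0].
have [h [b [m [h_gt0 box disj]]]] := cells_of_compacts cP.
have meet_conn j : connected (P j) -> cut_connected (@cell_adj m) (meeting h b m (P j)).
  by move=> cj; apply: meeting_connected => // p; apply: box.
have meets j k : P j `&` P k !=set0 ->
    exists2 c, c \in meeting h b m (P j) & c \in meeting h b m (P k).
  move=> [p [Pj Pk]]; have /andP[/(strip_cover h_gt0)[i pi] /(strip_cover h_gt0)[l pl]] := box j p Pj.
  by exists (i, l); apply/meetingP; exists p.
have [||||||| cls [cls_conn cls_link]] := @minor_of_cells _ V (@cell_adj m) (@cell_adj_sym m) oriented
   (fun u => meeting h b m (P (inl u))) (fun u v => meeting h b m (P (inr (u, v)))).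
- by move=> u; apply: meet_conn; apply: halo_connected.
- by move=> u v uv; apply: meet_conn; rewrite /= uv; apply: arc_connected => //; lra.
- move=> u v c cu cv; apply: contrapT => /eqP uv.
  by apply: (disj (inl u) (inl v) c) => //; apply: halo_disjoint.
- move=> u v w c uv cuv cw; have [->|wu] := eqVneq w u; first by left.
  have [->|wv] := eqVneq w v; first by right.
  by exfalso; apply: (disj (inr (u, v)) (inl w) c) => //=; rewrite uv; apply: bridge_halo.
- move=> u v u' v' c uv uv' cuv cuv'; have [[-> ->] //|ne] := eqVneq (u, v) (u', v').
  exfalso; apply: (disj (inr (u, v)) (inr (u', v')) c) => //=.
  by rewrite uv uv'; apply: bridge_disjoint.
- by move=> u v uv; split; apply: meets; rewrite /= uv; have [] := bridge_ends uv.
- by move=> u; rewrite /oriented adj_irr.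
apply: (grid_minor_rotation (cls := cls)) => // u v uv.
case: (ltngtP (enum_rank u) (enum_rank v)) => [luv|lvu|/val_inj/enum_rank_inj E].
- by apply: cls_link; rewrite /oriented uv.
- have [|c [d [cd cv du]]] := cls_link v u; first by rewrite /oriented adjC uv.
  by exists d, c; rewrite cell_adj_sym.
by rewrite E adj_irr in uv.
Qed.

End PlanarRotation.

(** * Planar graphs without 4-cycles: induction and conclusion *)

Section PlanarGraphRotation.
Local Open Scope classical_set_scope.
Local Open Scope ring_scope.

Lemma planar_rotation (R : realType) (V : finType) (adj : rel V) :
  symmetric adj -> irreflexive adj -> planar R adj ->
  exists (D : finType) (src : D -> V) (e n : {perm D}), rotation_system adj src e n.
Proof.
move=> adjC adj_irr [pos [A drawing]].
have ex_g (uv : V * V) : exists g : R -> R * R, adj uv.1 uv.2 ->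
    [/\ {within `[0, 1], continuous g}, {in `[0, 1] &, injective g}, g 0 = pos uv.1,
      g 1 = pos uv.2 & A uv.1 uv.2 = g @` `[0, 1]].
  case: uv => u v /=; have [uv|nuv] := boolP (adj u v); last by exists (fun=> pos u).
  by have [g gP] := edge_arc drawing uv; exists g.
have [g gP] := choice ex_g.
apply: (@drawing_rotation R V adj adjC adj_irr pos A (fun u v => g (u, v)) drawing).
by move=> u v /andP[uv _]; apply: (gP (u, v)).
Qed.

End PlanarGraphRotation.

Lemma planar_subgraph (R : realType) (V : finType) (adj adj' : rel V) :
  subrel adj' adj -> planar R adj -> planar R adj'.
Proof.
move=> sub [pos [A [pos_inj arcs symA vert cross]]]; exists pos, A; split=> //.
- by move=> u v /sub; apply: arcs.
- by move=> u v /sub; apply: symA.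
- by move=> u v w /sub; apply: vert.
by move=> u v x y /sub uv /sub xy; apply: cross.
Qed.

Lemma no_kcycle4 (V : finType) (adj : rel V) a b c d :
  irreflexive adj -> ~ has_kcycle adj 4 ->
  adj a b -> adj b c -> adj c d -> adj d a -> a != c -> b != d -> False.
Proof.
move=> adj_irr noC4 ab bc cd da ac bd; apply: noC4; exists [:: a; b; c; d].
have neq x y : adj x y -> x != y by apply: contraTneq => ->; rewrite adj_irr.
split=> //=; last by rewrite ab bc cd da.
by rewrite !inE !negb_or (neq _ _ ab) ac eq_sym (neq _ _ da) (neq _ _ bc) bd (neq _ _ cd).
Qed.

Lemma planar_colorable (R : realType) (V : finType) (adj : rel V) :
  symmetric adj -> irreflexive adj -> planar R adj -> ~ has_kcycle adj 4 -> colorable adj.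
Proof.
have [k] := ubnP #|[set uv | adj uv.1 uv.2]%SET|.
elim: k adj => // k IHk adj; rewrite ltnS => le_k adjC adj_irr plan noC4.
apply: contrapT => ncol.
have sub x : subrel (del_vertex adj x) adj by move=> u v /and3P[].
have crit : critical adj.
  split=> // x v xv; apply: IHk.
  - apply: leq_trans le_k; apply/proper_card/properP; split.
      by apply/fintype.subsetP => -[u w]; rewrite !inE; apply: sub.
    by exists (x, v); rewrite !inE //= /del_vertex eqxx andbF.
  - by move=> u w; rewrite /del_vertex adjC [(u != x) && _]andbC.
  - by move=> u; rewrite /del_vertex adj_irr.
  - exact: planar_subgraph plan.
  move=> [s [s4 us cs]]; apply: noC4; exists s; split=> //.
  by apply: sub_cycle cs; apply: sub.
have [D [src [e [n rot]]]] := planar_rotation adjC adj_irr plan.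
have D0 : #|D| = 0.
  by apply: (critical_no_darts crit _ rot) => a b c d; apply: no_kcycle4.
(* Without darts there are no edges, so a single independent set suffices. *)
apply: ncol; exists (fun=> Some true); split=> // u v uv.
have [x _ _] := rs_surj rot uv.
by have := max_card (pred1 x); rewrite D0 card1.
Qed.

Theorem theorem4p3 (R : realType) (V : finType) (adj : rel V)
    (adj_sym : symmetric adj) (adj_irr : irreflexive adj)
    (adj_planar : planar R adj) (no_C4 : ~ has_kcycle adj 4) :
  exists I1 I2 D : {set V},
    [/\ (I1 :|: I2 :|: D)%SET = [set: V]%SET,
        [disjoint I1 & I2], [disjoint I1 & D] & [disjoint I2 & D]] /\
    [/\ independent adj I1, independent adj I2
      & induced_max_degree adj D <= 117].
Proof.
have [c [c_prop c_def]] := planar_colorable adj_sym adj_irr adj_planar no_C4.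
pose part k := [set v | c v == k]%SET.
have disj k l : k != l -> [disjoint part k & part l].
  move=> kl; rewrite -setI_eq0; apply/eqP/setP => v; rewrite !inE.
  by apply: contraNF kl => /andP[/eqP <- /eqP <-].
have indep b : independent adj (part (Some b)).
  move=> u v; rewrite !inE => /eqP cu /eqP cv; apply/negP => /c_prop.
  by rewrite cu cv => /(_ erefl).
exists (part (Some true)), (part (Some false)), (part None); split; split; try exact: disj.
- by apply/setP => v; rewrite !inE; case: (c v) => [[]|].
- exact: indep.
- exact: indep.
apply/bigmax_leqP => v; rewrite inE => /eqP cv.
apply: leq_trans (c_def v cv); apply/subset_leq_card/fintype.subsetP => u.
by rewrite !inE andbC.
Qed.
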